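(* Let $G$ be a connected, locally finite graph, and suppose that $\mathrm{Aut}(G)$ has a transitive nonunimodular subgroup. Then there exists a constant $C$ such that $$\frac{z_c}{z_c-z} \leq \chi(z) \leq \frac{C z_c}{z_c-z} \quad\text{ and }\quad \mu_c^n \leq Z(n) \leq C\mu_c^n$$ for every $0\leq z<z_c$ and every integer $n\geq 0$.
   Context: Let $G=(V,E)$ be a connected, locally finite graph with automorphism group $\mathrm{Aut}(G)$. A subgroup $\Gamma\subseteq \mathrm{Aut}(G)$ is transitive if for any $u,v\in V$ there is $\gamma\in\Gamma$ with $\gamma u=v$. The modular function $\Delta=\Delta_\Gamma:V^2\to(0,\infty)$ of a transitive subgroup $\Gamma$ is $\Delta(x,y)=|\mathrm{Stab}_y x|/|\mathrm{Stab}_x y|$, where $\mathrm{Stab}_x y$ is the orbit of $y$ under the stabilizer of $x$ in $\Gamma$. $\Gamma$ is unimodular if $\Delta\equiv 1$, and nonunimodular otherwise. A self-avoiding walk (SAW) is a path in $G$ visiting each vertex at most once. Fix a root vertex $0\in V$ and let $Z(n)$ be the number of SAWs of length $n$ (i.e. with $n$ steps) in $G$ starting at $0$. The connective constant is $\mu_c=\lim_{n\to\infty}Z(n)^{1/n}=\inf_{n\ge1}Z(n)^{1/n}$ (the limit exists since $Z(n+m)\le Z(n)Z(m)$), $z_c=\mu_c^{-1}$, and the susceptibility is $\chi(z)=\sum_{n\ge0}z^nZ(n)$. *)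

(* Defs.v *)
From HB Require Import structures.
From mathcomp Require Import all_boot all_order all_algebra finmap.
From mathcomp Require Import all_classical all_reals all_analysis.
Set Implicit Arguments.
Unset Strict Implicit.
Unset Printing Implicit Defensive.
Import Order.TTheory GRing.Theory Num.Theory.
Import numFieldNormedType.Exports.
Local Open Scope classical_set_scope.
Local Open Scope ring_scope.

Definition simple_graph (V : choiceType) (e : rel V) : Prop :=
  symmetric e /\ irreflexive e.

Definition connected_graph (V : choiceType) (e : rel V) : Prop :=
  forall x y : V, exists2 s : seq V, path e x s & last x s = y.

Definition locally_finite (V : choiceType) (e : rel V) : Prop :=
  forall x : V, finite_set [set y | e x y].

Definition graph_Aut (V : choiceType) (e : rel V) : set (V -> V) :=
  [set g | bijective g /\ forall x y, e (g x) (g y) = e x y].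

Definition Aut_subgroup (V : choiceType) (e : rel V) (Gam : set (V -> V)) : Prop :=
  [/\ Gam `<=` graph_Aut e,
      Gam id,
      forall g h, Gam g -> Gam h -> Gam (g \o h) &
      forall g h, Gam g -> cancel g h -> cancel h g -> Gam h].

Definition transitive_action (V : choiceType) (Gam : set (V -> V)) : Prop :=
  forall u v : V, exists2 g, Gam g & g u = v.

Definition stab (V : choiceType) (Gam : set (V -> V)) (x : V) : set (V -> V) :=
  [set g | Gam g /\ g x = x].

Definition stab_orbit (V : choiceType) (Gam : set (V -> V)) (x y : V) : set V :=
  [set g y | g in stab Gam x].

(* fset_set is empty on infinite sets.  In a connected locally finite graph
   balls are finite, so every stab_orbit below and every set of walks of given
   length is finite and the cardinals are the true ones. *)
Definition modular_function (R : realType) (V : choiceType)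
    (Gam : set (V -> V)) (x y : V) : R :=
  #|` fset_set (stab_orbit Gam y x)|%:R / #|` fset_set (stab_orbit Gam x y)|%:R.

Definition unimodular (R : realType) (V : choiceType) (Gam : set (V -> V)) : Prop :=
  forall x y : V, modular_function R Gam x y = 1.

(* The walk o, s_1, ..., s_n is encoded by s, without its starting vertex. *)
Definition SAW (V : choiceType) (e : rel V) (o : V) (n : nat) : set (seq V) :=
  [set s | [/\ size s = n, path e o s & uniq (o :: s)]].

Definition SAW_count (V : choiceType) (e : rel V) (o : V) (n : nat) : nat :=
  #|` fset_set (SAW e o n)|.

Definition connective_constant (R : realType) (V : choiceType) (e : rel V)
    (o : V) : R :=
  limn (fun n : nat => (SAW_count e o n)%:R `^ (n%:R^-1) : R).

Definition critical_z (R : realType) (V : choiceType) (e : rel V) (o : V) : R :=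
  (connective_constant R e o)^-1.

Definition susceptibility (R : realType) (V : choiceType) (e : rel V) (o : V)
    (z : R) : \bar R :=
  (\sum_(0 <= n <oo) (z ^+ n * (SAW_count e o n)%:R)%:E)%E.

(* Main.v *)
Require Import Defs.
From HB Require Import structures.
From mathcomp Require Import all_boot all_order all_algebra finmap.
From mathcomp Require Import all_classical all_reals all_analysis.
From mathcomp Require Import lra.
Set Implicit Arguments.
Unset Strict Implicit.
Unset Printing Implicit Defensive.
Import Order.TTheory GRing.Theory Num.Theory.
Import numFieldNormedType.Exports.
Local Open Scope classical_set_scope.
Local Open Scope ring_scope.

(** Let [m x = Delta(o, x)], so that [Delta(x, y) = m y / m x]; think of [m] as a
height, defined up to a positive factor on which automorphisms act.  Counting
walks is invariant under the group, and the mass-transport principle trades a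
walk from [x] to [y] for the reversed walk at the price of [Delta(x, y)].  The
idea is to compare walks with bridges: self-avoiding walks that start strictly
above all their other points and end at a lowest one.

Bridges concatenate to bridges and fixed lengths make the concatenation
injective, so the number [b n] of bridges of length [n] is supermultiplicative
and [b n <= mu ^ n] ([supermul_le_exp]).  Weigh each walk from [x] to [y] by the
tilt [sqrt Delta(x, y)].  Nonunimodularity enters here: consecutive cut points
of a bridge drop by a definite factor, because a descending step has one of
finitely many height ratios, so the tilts at the cut points of a bridge add up
to at most a constant [K] ([cut_sum_le]).  Summing over the cut points of all
bridges of length [n] gives [\sum_k b' k * b (n - k) <= K * b n], where [b'] is
the tilted count, and since [b n / mu ^ n] stays bounded this renewal inequality
forces [\sum_k b' k / mu ^ k <= K] at the critical point itself
([renewal_sum_le], [tilted_bridge_sum_le]).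

The Hammersley-Welsh decomposition cuts a half-space walk at its last extremal
point, again and again, into alternating downward and upward bridges of strictly
decreasing spans.  Under reversal and mass transport an upward bridge has the
same tilted weight as a downward bridge of the same span ([up_bridge_sum]), so
the tilted half-space walks are summable at the critical point, by
the exponential of a multiple of [\sum_k b' k / mu ^ k] ([half_sum_le_exp]).

Finally, cut an arbitrary self-avoiding walk at its last highest point, and the
second piece at its last lowest point.  The middle piece is a bridge, whose number
is at most [mu] to its length.  The first piece, reversed, lies below its start
and carries the weight [Delta <= sqrt Delta]; the last piece lies above its start,
where [1 <= sqrt Delta].  Both outer pieces are thus dominated by tilted half-space
walks, which are summable, and [Z n <= C * mu ^ n] follows ([saw_count_le]).  The
reverse bound is submultiplicativity ([fekete]), and the bounds on the
susceptibility are those on [Z n] summed against a geometric series. *)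

(** * Real-variable lemmas *)

Section RealLemmas.
Variable R : realType.
Implicit Types (r : R).

Lemma bernoulli_ineq r (n : nat) : 1 <= r -> 1 + n%:R * (r - 1) <= r ^+ n.
Proof.
move=> r1; elim: n => [|n IH]; first by rewrite mul0r addr0 expr0.
rewrite exprS -natr1.
have : r * (1 + n%:R * (r - 1)) <= r * r ^+ n by rewrite ler_wpM2l //; lra.
apply: le_trans.
have : 0 <= n%:R * ((r - 1) * (r - 1)) :> R.
  by rewrite !mulr_ge0 // subr_ge0.
nra.
Qed.

Lemma geometric_le_linear r (N : nat) :
  (forall j : nat, r ^+ j <= 1 + (j * N)%:R) -> r <= 1.
Proof.
move=> H; rewrite leNgt; apply/negP => r1.
pose d : R := r - 1.
have d0 : 0 < d by rewrite /d; lra.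
have bern j : 1 + j%:R * d <= r ^+ j by apply: bernoulli_ineq; lra.
have [j jN] : exists j : nat, 2 * N%:R / (d ^+ 2) < j%:R :> R.
  exists (Num.truncn (2 * N%:R / (d ^+ 2))).+1; exact: truncnS_gt.
have d20 : 0 < d ^+ 2 by exact: exprn_gt0.
rewrite ltr_pdivrMr // in jN.
have j0 : 0 < j%:R :> R.
  rewrite -(pmulr_lgt0 _ d20); apply: le_lt_trans jN; exact: mulr_ge0.
(* Bernoulli squared is quadratic in [j] and beats the linear bound. *)
have := H (j * 2)%N; rewrite exprM => H2.
have : (1 + j%:R * d) ^+ 2 <= (r ^+ j) ^+ 2.
  rewrite ler_pXn2r // ?nnegrE ?bern //; last by apply: exprn_ge0; lra.
  by rewrite addr_ge0 // mulr_ge0 // ltW.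
move=> /le_trans /(_ H2); apply/negP; rewrite -ltNge !natrM.
have : j%:R * (2 * N%:R) < j%:R * (j%:R * d ^+ 2) by rewrite ltr_pM2l.
have : 0 < j%:R * d by rewrite mulr_gt0.
rewrite !expr2; nra.
Qed.

Lemma triangle_sum (A : nat -> nat -> R) (N : nat) :
  \sum_(n < N) \sum_(k < n.+1) A k (n - k)%N =
  \sum_(k < N) \sum_(l < N - k) A k l.
Proof.
elim: N => [|N IH]; first by rewrite !big_ord0.
rewrite big_ord_recr /= IH.
have -> : \sum_(k < N.+1) \sum_(l < N.+1 - k) A k l =
    \sum_(k < N.+1) (\sum_(l < N - k) A k l + A k (N - k)%N).
  apply: eq_bigr => k _.
  by rewrite subSn -1?ltnS // big_ord_recr.
by rewrite big_split /= [in RHS]big_ord_recr /= subnn big_ord0 addr0.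
Qed.

Lemma ler_sum_prefix (f : nat -> R) (m n : nat) :
  (forall i, 0 <= f i) -> (m <= n)%N -> \sum_(i < m) f i <= \sum_(i < n) f i.
Proof.
move=> f0 mn; rewrite -(subnKC mn) big_split_ord /= lerDl.
by apply: sumr_ge0.
Qed.

(** The hypothesis is a renewal inequality. If a partial sum of [p] exceeded [K],
then [N] more terms would multiply the partial sums of [a] by a factor larger than
[1]; they would grow exponentially, but they grow at most linearly. *)
Lemma renewal_sum_le (p a : nat -> R) (K : R) :
  0 < K -> (forall k, 0 <= p k) -> (forall n, 0 <= a n <= 1) -> a 0%N = 1 ->
  (forall n, \sum_(k < n.+1) p k * a (n - k)%N <= K * a n) ->
  forall N, \sum_(k < N) p k <= K.
Proof.
move=> K0 p0 a01 a0 H N.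
have a_ge0 n : 0 <= a n by case/andP: (a01 n).
pose f M := \sum_(n < M) a n.
have step M : (\sum_(k < N) p k) / K * f M <= f (M + N)%N.
  rewrite mulrAC ler_pdivrMr //; apply: (@le_trans _ _ (\sum_(n < M + N) K * a n)).
    apply: (@le_trans _ _ (\sum_(n < M + N) \sum_(k < n.+1) p k * a (n - k)%N)).
      rewrite (triangle_sum (fun k l => p k * a l)).
      have -> : (\sum_(k < N) p k) * f M = \sum_(k < N) \sum_(l < M) p k * a l.
        by rewrite mulr_suml; apply: eq_bigr => k _; rewrite mulr_sumr.
      apply: (@le_trans _ _ (\sum_(k < N) \sum_(l < M + N - k) p k * a l)).
        apply: ler_sum => k _.
        apply: (ler_sum_prefix (f := fun l => p k * a l)) => [i|]; first exact: mulr_ge0.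
        by rewrite -addnBA ?leq_addr // ltnW.
      apply: (ler_sum_prefix (f := fun k => \sum_(l < M + N - k) p k * a l)).
        by move=> i; apply: sumr_ge0 => j _; exact: mulr_ge0.
      exact: leq_addl.
    by apply: ler_sum => n _; exact: H.
  by rewrite -mulr_sumr mulrC.
have P0 : 0 <= (\sum_(k < N) p k) / K by rewrite divr_ge0 ?sumr_ge0 // ltW.
rewrite -[K]mul1r -ler_pdivrMr //; apply: (@geometric_le_linear _ N) => j.
apply: (@le_trans _ _ (f (1 + j * N)%N)).
  elim: j => [|j IH]; first by rewrite expr0 /f big_ord_recl big_ord0 /= a0 addr0.
  rewrite exprS; apply: le_trans (ler_wpM2l P0 IH) _.
  by apply: le_trans (step _) _; rewrite -addnA mulSn [(N + _)%N]addnC.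
have -> : 1 + (j * N)%:R = \sum_(n < 1 + j * N) (1 : R).
  by rewrite sumr_const card_ord natrD.
by apply: ler_sum => n _; case/andP: (a01 n).
Qed.

Section Fekete.
Variable Z : nat -> R.
Hypothesis Z_ge1 : forall n, 1 <= Z n.
Hypothesis Z_submul : forall m n, Z (m + n)%N <= Z m * Z n.

Let u n := Z n `^ n%:R^-1.

Lemma root_exprK n : (0 < n)%N -> u n ^+ n = Z n.
Proof.
move=> n0; have Zn0 : 0 <= Z n by apply: le_trans (Z_ge1 n).
rewrite /u -powR_mulrn ?powR_ge0 // -powRrM mulVf ?powRr1 //.
by rewrite pnatr_eq0 -lt0n.
Qed.

Lemma root_ge1 n : 1 <= u n.
Proof.
have := ge0_ler_powR (r := n%:R^-1 : R) _ _ _ (Z_ge1 n).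
rewrite powR1; apply; rewrite ?invr_ge0 // nnegrE //.
exact: le_trans (Z_ge1 n).
Qed.

(** Divide [n] by [k]: the quotient contributes a power of [Z k], and the sum bounds
the contribution of the remainder. *)
Lemma submul_exp_le k n : (0 < k)%N ->
  Z n <= (\sum_(s < k) Z s) * u k ^+ n.
Proof.
move=> k0; have Z0 m : 0 <= Z m by apply: le_trans (Z_ge1 m).
have mulk q s : Z (q * k + s)%N <= Z k ^+ q * Z s.
  elim: q => [|q IH]; first by rewrite expr0 mul1r.
  rewrite mulSn -addnA exprS -mulrA; apply: le_trans (Z_submul _ _) _.
  exact: ler_wpM2l.
rewrite {1}(divn_eq n k); apply: le_trans (mulk _ _) _.
rewrite mulrC; apply: ler_pM => //; first exact: exprn_ge0.
  rewrite (bigD1 (Ordinal (ltn_pmod n k0))) //= lerDl.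
  exact: sumr_ge0.
rewrite -{1}(root_exprK k0) -exprM mulnC; apply: ler_weXn2l; first exact: root_ge1.
exact: leq_divM.
Qed.

Lemma fekete : exists2 L : R, u n @[n --> \oo] --> L & forall n, L ^+ n <= Z n.
Proof.
pose A := [set u k | k in [set k | (0 < k)%N]].
have Albd : lbound A 1 by move=> _ [k _ <-]; exact: root_ge1.
have Ahas : has_inf A by split; [exists (u 1%N), 1%N|exists 1].
have L1 : 1 <= inf A by apply: lb_le_inf Albd; exact: Ahas.1.
have Lle n : (0 < n)%N -> inf A <= u n.
  by move=> n0; apply: ge_inf; [exact: Ahas.2|exists n].
exists (inf A); last first.
  case=> [|n]; first by rewrite expr0.
  rewrite -root_exprK // ler_pXn2r // ?nnegrE ?Lle //.
    exact: le_trans L1.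
  exact: powR_ge0.
apply/cvgrPdist_le => eps eps0.
have [_ [k k0 <-] ukL] := inf_adherent eps0 Ahas.
have uk1 := root_ge1 k.
pose rho := (inf A + eps) / u k.
have uk0 : 0 < u k by apply: lt_le_trans uk1.
have rho1 : 1 < rho by rewrite ltr_pdivlMr // mul1r.
pose M := \sum_(s < k) Z s.
exists (Num.truncn (M / (rho - 1))).+1 => // n /= Nn.
have n0 : (0 < n)%N by apply: leq_trans Nn.
rewrite distrC ger0_norm ?subr_ge0 ?Lle // lerBlDl.
rewrite -(@ler_pXn2r _ n) ?nnegrE ?powR_ge0 //; last by lra.
rewrite root_exprK //; apply: le_trans (submul_exp_le n k0) _.
have -> : inf A + eps = rho * u k by rewrite /rho divfK // gt_eqF.
rewrite exprMn ler_pM2r; last exact: exprn_gt0.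
apply: le_trans (bernoulli_ineq n (ltW rho1)).
have : M / (rho - 1) < n%:R.
  apply: lt_le_trans (truncnS_gt _) _; by rewrite ler_nat.
by rewrite ltr_pdivrMr ?subr_gt0 //; rewrite /M; lra.
Qed.

(** Compare the lengths [n * m], along which the root of [Z] tends to [L]. *)
Lemma supermul_le_exp (b : R) (L : R) n : u n @[n --> \oo] --> L -> 0 <= b ->
  (0 < n)%N -> (forall m, b ^+ m <= Z (n * m)%N) -> b <= L ^+ n.
Proof.
move=> uL b0 n0 bZ.
have cvg_sub : u (n * m.+1)%N ^+ n @[m --> \oo] --> L ^+ n.
  suff uL' : u (n * m.+1)%N @[m --> \oo] --> L.
    exact: (cvg_comp _ _ uL' (@exprn_continuous _ n L)).
  suff sub : (n * m.+1)%N @[m --> \oo] --> \oo by exact: (cvg_comp _ _ sub uL).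
  apply/cvgnyPge => K; exists K => // m /= Km.
  by apply: leq_trans Km _; apply: leq_trans (leqnSn m) _; exact: leq_pmull.
rewrite -(cvg_lim _ cvg_sub) //; apply: limr_ge; first by apply/cvg_ex; eexists; exact: cvg_sub.
near=> m; rewrite -(@ler_pXn2r _ m.+1) ?nnegrE ?exprn_ge0 ?powR_ge0 //.
by rewrite -exprM root_exprK ?bZ // muln_gt0 n0.
Unshelve. all: by end_near.
Qed.

End Fekete.

(** Half-space walks split into bridges of strictly decreasing spans, so their
weight is at most the product of [1 + x] over the spans; this is an exponential
form of that bound, with [r i] the span and [x i] the weight of the bridge [i].
Sorted by decreasing [r], each item costs one use of [1 + x <= expR x]. *)
Lemma sum_decreasing_le_exp (I : eqType) (l : seq I) (x r : I -> R) t :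
  (forall i, 0 <= x i) ->
  1 + \sum_(i <- l | r i < t) x i * expR (\sum_(j <- l | r j < r i) x j) <=
  expR (\sum_(i <- l | r i < t) x i).
Proof.
move=> x0.
pose ge i j := r j <= r i.
have ge_tot : total ge by move=> i j; rewrite /ge; exact: le_total.
have ge_tr : transitive ge by move=> i j k /[swap]; rewrite /ge; exact: le_trans.
rewrite -(perm_big _ (permEl (perm_sort ge l))) /=.
under eq_bigr => i _ do rewrite -(perm_big _ (permEl (perm_sort ge l))) /=.
rewrite -[X in _ <= expR X](perm_big _ (permEl (perm_sort ge l))) /=.
have := sort_sorted ge_tot l; move: (sort ge l) => {}l.
rewrite (sorted_pairwise ge_tr).
elim: l => [|a l IH] /=; first by rewrite !big_nil expR0 addr0.
case/andP=> /allP al {}/IH IH; rewrite !big_cons.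
have drop : \sum_(i <- l | r i < t)
      x i * expR (\sum_(j <- a :: l | r j < r i) x j) =
    \sum_(i <- l | r i < t) x i * expR (\sum_(j <- l | r j < r i) x j).
  rewrite big_seq_cond [in RHS]big_seq_cond; apply: eq_bigr => i /andP[il _].
  by rewrite big_cons ltNge [r i <= r a](al _ il).
rewrite drop; case: ifP => // rat.
rewrite ltxx.
have le1 : expR (\sum_(j <- l | r j < r a) x j) <=
           expR (\sum_(i <- l | r i < t) x i).
  rewrite ler_expR big_mkcond [leRHS]big_mkcond; apply: ler_sum => j _.
  case: ifP => h; first by rewrite (lt_trans h rat).
  by case: ifP.
have := ler_wpM2l (x0 a) le1.
rewrite expRD; have := expR_ge1Dx (x a).
have := expR_gt0 (\sum_(i <- l | r i < t) x i).
move: IH; set E := expR _; set S := \sum_(i <- l | _) _ * _; move=> IH E0.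
move=> /(ler_wpM2r (ltW E0)); lra.
Qed.

End RealLemmas.

(** * Sums over walks *)

Section Walks.
Variables (R : realType) (V : choiceType) (nb : V -> seq V).

Fixpoint walks (n : nat) (x : V) : seq (seq V) :=
  if n is n'.+1 then [seq y :: s | y <- nb x, s <- walks n' y] else [:: [::]].

(** All estimates on families of walks below are pointwise inequalities between
weights under this sum; self-avoidance is just one more factor of the weight. *)
Definition wsum (n : nat) (x : V) (F : seq V -> R) : R := \sum_(s <- walks n x) F s.

Lemma wsum0 x F : wsum 0 x F = F [::].
Proof. by rewrite /wsum big_seq1. Qed.

Lemma wsumS n x F :
  wsum n.+1 x F = \sum_(y <- nb x) wsum n y (fun s => F (y :: s)).
Proof. by rewrite /wsum /= big_allpairs_dep. Qed.

Lemma mem_walks n x s : (s \in walks n x) =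
  (size s == n) && path (fun u v => v \in nb u) x s.
Proof.
elim: n x s => [|n IH] x [|y s] //=.
  by apply/negbTE/negP => /allpairsPdep[y [s [_ _]]].
rewrite eqSS; apply/allpairsPdep/idP.
  move=> [y' [s' [yx s'w [-> ->]]]]; move: s'w; rewrite IH => /andP[-> ->].
  by rewrite yx.
by case/and3P=> sn yx ps; exists y, s; split=> //; rewrite IH sn.
Qed.

Lemma walks_uniq n x : (forall y, uniq (nb y)) -> uniq (walks n x).
Proof.
move=> nbu; elim: n x => [|n IH] x //=.
by apply: allpairs_uniq_dep => // -[y s] [y' s'] _ _ [-> ->].
Qed.

Lemma eq_wsum n x F G :
  (forall s, size s = n -> path (fun u v => v \in nb u) x s -> F s = G s) ->
  wsum n x F = wsum n x G.
Proof.
move=> FG; rewrite /wsum; apply: eq_big_seq => s.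
by rewrite mem_walks => /andP[/eqP sn ps]; exact: FG.
Qed.

Lemma ler_wsum n x F G :
  (forall s, size s = n -> path (fun u v => v \in nb u) x s -> F s <= G s) ->
  wsum n x F <= wsum n x G.
Proof.
move=> FG; rewrite /wsum big_seq [leRHS]big_seq; apply: ler_sum => s.
by rewrite mem_walks => /andP[/eqP sn ps]; exact: FG.
Qed.

Lemma wsum_ge0 n x F : (forall s, 0 <= F s) -> 0 <= wsum n x F.
Proof. by move=> F0; apply: sumr_ge0. Qed.

Lemma wsumZ n x c F : wsum n x (fun s => c * F s) = c * wsum n x F.
Proof. by rewrite /wsum mulr_sumr. Qed.

Lemma wsumZr n x c F : wsum n x (fun s => F s * c) = wsum n x F * c.
Proof. by rewrite /wsum mulr_suml. Qed.

Lemma wsum_sum n x (I : Type) (r : seq I) (P : pred I) (F : I -> seq V -> R) :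
  wsum n x (fun s => \sum_(i <- r | P i) F i s) = \sum_(i <- r | P i) wsum n x (F i).
Proof. exact: exchange_big. Qed.

Lemma wsum_cat k l x F :
  wsum (k + l) x F = wsum k x (fun s => wsum l (last x s) (fun t => F (s ++ t))).
Proof.
elim: k x F => [|k IH] x F; first by rewrite add0n wsum0.
by rewrite addSn !wsumS; apply: eq_bigr => y _; rewrite IH.
Qed.

Lemma wsum_rcons n x F :
  wsum n.+1 x F = wsum n x (fun s => \sum_(y <- nb (last x s)) F (rcons s y)).
Proof.
rewrite -addn1 wsum_cat; apply: eq_wsum => s _ _.
rewrite wsumS; apply: eq_bigr => y _.
by rewrite wsum0 cats1.
Qed.

Lemma wsum_split k n x (F : seq V -> seq V -> R) : (k <= n)%N ->
  wsum n x (fun s => F (take k s) (drop k s)) =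
  wsum k x (fun s => wsum (n - k) (last x s) (F s)).
Proof.
move=> kn; rewrite -{1}(subnKC kn) wsum_cat; apply: eq_wsum => s sk _.
apply: eq_wsum => t _ _.
by rewrite take_size_cat // drop_size_cat.
Qed.

(** ** Reversal and mass transport *)

Section Invariance.
Variable Gam : set (V -> V).
Hypothesis nb_uniq : forall x, uniq (nb x).
Hypothesis Gam_inj : forall g, Gam g -> injective g.
Hypothesis nb_Gam : forall g x, Gam g -> nb (g x) =i map g (nb x).

Definition invariant (F : V -> seq V -> R) :=
  forall g x s, Gam g -> F (g x) (map g s) = F x s.

Lemma wsum_Gam n x F g : Gam g -> wsum n (g x) F = wsum n x (fun s => F (map g s)).
Proof.
move=> Gg; elim: n x F => [|n IH] x F; first by rewrite !wsum0.
rewrite !wsumS (perm_big (map g (nb x))) /=.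
  by rewrite big_map; apply: eq_bigr => y _; rewrite IH.
apply: uniq_perm => //; last exact: nb_Gam.
by rewrite map_inj_uniq //; exact: Gam_inj.
Qed.

Lemma wsum_invariant n x F g : invariant F -> Gam g ->
  wsum n (g x) (F (g x)) = wsum n x (F x).
Proof.
move=> Finv Gg; rewrite wsum_Gam //; apply: eq_wsum => s _ _; exact: Finv.
Qed.

Variable m : V -> R.
Hypothesis m_gt0 : forall x, 0 < m x.
Hypothesis m_Gam : forall g x y, Gam g -> m (g x) / m (g y) = m x / m y.
Hypothesis edge_mass_transport : forall (f : V -> V -> R) x,
  (forall g u v, Gam g -> f (g u) (g v) = f u v) ->
  \sum_(y <- nb x) f x y = \sum_(y <- nb x) m y / m x * f y x.

(** Iterating the transport along an edge transports along a walk: a walk from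
[x] is traded for the reversed walk, at the price of the modular factor of its
two ends. *)
Lemma wsum_rev n x (F : V -> seq V -> R) : invariant F ->
  wsum n x (F x) =
  wsum n x (fun s => m (last x s) / m x * F (last x s) (rev (belast x s))).
Proof.
elim: n x F => [|n IH] x F Finv.
  by rewrite !wsum0 /= divff ?mul1r // gt_eqF.
rewrite wsumS.
rewrite (edge_mass_transport (f := fun u v => wsum n v (fun s => F u (v :: s)))).
  pose G u s := \sum_(y <- nb u) m y / m u * F y (u :: s).
  have Ginv : invariant G.
    move=> g u s Gg; rewrite /G (perm_big (map g (nb u))) /=.
      rewrite big_map; apply: eq_bigr => y _.
      by rewrite m_Gam // -(Finv g y (u :: s)).
    apply: uniq_perm => //; last exact: nb_Gam.
    by rewrite map_inj_uniq //; exact: Gam_inj.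
  transitivity (wsum n x (G x)).
    rewrite /G wsum_sum; apply: eq_bigr => y _; by rewrite wsumZ.
  rewrite IH // wsum_rcons; apply: eq_wsum => s _ _.
  rewrite /G mulr_sumr; apply: eq_bigr => y _.
  rewrite last_rcons belast_rcons (lastI x s) rev_rcons.
  have := m_gt0 (last x s); have := m_gt0 x => mx ml.
  rewrite mulrA; congr (_ * _).
  by rewrite mulrC mulrA divfK // gt_eqF.
move=> g u v Gg; rewrite wsum_Gam //; apply: eq_wsum => s _ _.
by rewrite -(Finv g u (v :: s)).
Qed.

End Invariance.
End Walks.

(** * The modular function as a ratio of heights *)

Section Modular.
Variables (R : realType) (V : choiceType) (e : rel V) (Gam : set (V -> V)).
Hypothesis e_simple : simple_graph e.
Hypothesis e_connected : connected_graph e.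
Hypothesis e_locally_finite : locally_finite e.
Hypothesis Gam_group : Aut_subgroup e Gam.
Hypothesis Gam_transitive : transitive_action Gam.

Definition neighbours (x : V) : seq V := fset_set [set y | e x y].
Local Notation nb := neighbours.

Lemma neighbours_uniq x : uniq (nb x).
Proof. exact: fset_uniq. Qed.

Lemma mem_neighbours x y : (y \in nb x) = e x y.
Proof.
rewrite /nb in_fset_set; last exact: e_locally_finite.
by apply/idP/idP; rewrite inE.
Qed.

Lemma Gam_adj g x y : Gam g -> e (g x) (g y) = e x y.
Proof. by move=> Gg; case: Gam_group => /(_ g Gg)[_ ->]. Qed.

Lemma Gam_bij g : Gam g -> bijective g.
Proof. by move=> Gg; case: Gam_group => /(_ g Gg)[]. Qed.

Lemma Gam_inj g : Gam g -> injective g.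
Proof. by move=> /Gam_bij /bij_inj. Qed.

Lemma Gam_id : Gam id. Proof. by case: Gam_group. Qed.

Lemma Gam_comp g h : Gam g -> Gam h -> Gam (g \o h).
Proof. by case: Gam_group => _ _ + _; apply. Qed.

Lemma Gam_inv g : Gam g -> exists h, [/\ Gam h, cancel g h & cancel h g].
Proof.
move=> Gg; have [h gh hg] := Gam_bij Gg; exists h; split=> //.
by case: Gam_group => _ _ _; apply; [exact: Gg| |].
Qed.

Lemma neighbours_Gam g x : Gam g -> nb (g x) =i map g (nb x).
Proof.
move=> Gg y; have [h [_ gh hg]] := Gam_inv Gg; apply/idP/mapP.
  rewrite mem_neighbours -{1}(hg y) Gam_adj // => exy.
  by exists (h y); rewrite ?mem_neighbours ?hg.
by case=> z; rewrite mem_neighbours => exz ->; rewrite mem_neighbours Gam_adj.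
Qed.

(** A stabilizer of [x] maps a walk from [x] to [y] to walks of the same length
from [x], and these are finitely many. *)
Lemma finite_stab_orbit x y : finite_set (stab_orbit Gam x y).
Proof.
have [s es <-] := e_connected x y.
apply: (@sub_finite_set _ _ [set` map (last x) (walks nb (size s) x)]); last first.
  exact: finite_seq.
move=> _ [g [Gg gx] <-] /=; apply/mapP; exists (map g s); last first.
  by rewrite -{2}gx last_map.
rewrite mem_walks size_map eqxx /= -{1}gx.
rewrite path_map; apply: sub_path es => u v uv /=.
by rewrite mem_neighbours Gam_adj.
Qed.

Definition orbit_size x y : nat := #|` fset_set (stab_orbit Gam x y)|.

Lemma orbit_size_gt0 x y : (0 < orbit_size x y)%N.
Proof.
rewrite cardfs_gt0; apply/fset0Pn; exists y.
rewrite in_fset_set; last exact: finite_stab_orbit.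
by rewrite inE; exists id => //; split=> //; exact: Gam_id.
Qed.

Lemma card_fset_set_inj (T U : choiceType) (A : set T) (B : set U) (f : T -> U) :
  finite_set A -> set_bij A B f -> #|` fset_set B| = #|` fset_set A|.
Proof.
move=> finA [fA fI fS].
have -> : B = f @` A by rewrite eqEsubset; split=> // _ [x Ax <-]; exact: fA.
have BA : (f @` A #= A)%card := inj_card_eq fI.
by apply/fcard_eq => //; exact: finite_image.
Qed.

Lemma orbit_size_Gam g x y : Gam g -> orbit_size (g x) (g y) = orbit_size x y.
Proof.
move=> Gg; have [h [Gh gh hg]] := Gam_inv Gg.
apply: (card_fset_set_inj (f := g)); first exact: finite_stab_orbit.
split; [|by move=> u v _ _; exact: Gam_inj|].
  move=> _ [k [Gk kx] <-]; exists (g \o k \o h); last by rewrite /= gh.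
  by split; [exact: Gam_comp (Gam_comp _ _) _|rewrite /= gh kx].
move=> _ [k [Gk kx] <-]; exists (h (k (g y))); last by rewrite hg.
exists (h \o k \o g) => //; split; first exact: Gam_comp (Gam_comp _ _) _.
by rewrite /= kx gh.
Qed.

Definition stab2_orbit x y z : set V :=
  [set g z | g in [set g | [/\ Gam g, g x = x & g y = y]]].

Lemma finite_stab2_orbit x y z : finite_set (stab2_orbit x y z).
Proof.
apply: sub_finite_set (finite_stab_orbit x z) => _ [g [Gg gx gy] <-].
by exists g.
Qed.

Definition orbit2_size x y z : nat := #|` fset_set (stab2_orbit x y z)|.

Lemma orbit2_size_gt0 x y z : (0 < orbit2_size x y z)%N.
Proof.
rewrite cardfs_gt0; apply/fset0Pn; exists z.
rewrite in_fset_set; last exact: finite_stab2_orbit.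
by rewrite inE; exists id => //; split=> //; exact: Gam_id.
Qed.

Lemma orbit2_sizeC x y z : orbit2_size x y z = orbit2_size y x z.
Proof.
rewrite /orbit2_size; congr #|` fset_set _|.
by rewrite eqEsubset; split=> _ [g [Gg gx gy] <-]; exists g.
Qed.

Lemma card_fset_setX (T U : choiceType) (A : set T) (B : set U) :
  finite_set A -> finite_set B ->
  #|` fset_set (A `*` B)| = (#|` fset_set A| * #|` fset_set B|)%N.
Proof.
move=> finA finB; rewrite -(size_allpairs pair); apply: perm_size.
apply: uniq_perm; first exact: fset_uniq.
  by apply: allpairs_uniq; rewrite ?fset_uniq // => -[a b] [c d].
move=> [a b]; rewrite in_fset_set; last exact: finite_setX.
apply/idP/allpairsP => [|[[c d] /= [cA dB ->]]].
  rewrite inE /= => -[Aa Bb]; exists (a, b); split=> //=; by rewrite in_fset_set // inE.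
by move: cA dB; rewrite !in_fset_set // !inE.
Qed.

Definition pair_orbit x y z : set (V * V) := [set (g y, g z) | g in stab Gam x].

(** Orbit-stabilizer without a group of finite order: the fibre of the orbit of
pairs over a point [u] of the orbit of [y] is the translate, by any element that
moves [y] to [u], of the fibre over [y]. *)
Lemma card_pair_orbit x y z :
  #|` fset_set (pair_orbit x y z)| = (orbit_size x y * orbit2_size x y z)%N.
Proof.
have moveP u : exists g, stab_orbit Gam x y u -> [/\ Gam g, g x = x & g y = u].
  case: (pselect (stab_orbit Gam x y u)) => [[g [Gg gx] gy]|nu]; first by exists g.
  by exists id.
pose mv u := projT1 (cid (moveP u)).
have mvP u : stab_orbit Gam x y u -> [/\ Gam (mv u), mv u x = x & mv u y = u].
  exact: (projT2 (cid (moveP u))).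
have finA := finite_stab_orbit x y.
have finB := finite_stab2_orbit x y z.
rewrite -card_fset_setX //.
apply: (card_fset_set_inj (f := fun p => (p.1, mv p.1 p.2))).
  exact: finite_setX.
split.
- move=> [u v] /= [Au [h [Gh hx hy] hv]]; have [Gm mx my] := mvP _ Au.
  exists (mv u \o h) => /=; first by split; [exact: Gam_comp|rewrite /= hx].
  by rewrite hy my hv.
- move=> [u v] [u' v']; rewrite !inE /= => -[Au _] _ [uu' ]; subst u'.
  by have [Gm _ _] := mvP _ Au => /(Gam_inj Gm) ->.
- move=> _ [g [Gg gx] <-].
  have Agy : stab_orbit Gam x y (g y) by exists g.
  have [Gm mx my] := mvP _ Agy; have [h [Gh mh hm]] := Gam_inv Gm.
  exists (g y, h (g z)) => /=; last by rewrite hm.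
  split=> //; exists (h \o g) => //; split; first exact: Gam_comp.
    by rewrite /= gx -{1}mx mh.
  by rewrite /= -{1}my mh.
Qed.

Lemma orbit_sizeM x y z :
  (orbit_size x y * orbit2_size x y z = orbit_size x z * orbit2_size x z y)%N.
Proof.
rewrite -!card_pair_orbit; apply: (card_fset_set_inj (f := fun p => (p.2, p.1))).
  rewrite -[pair_orbit _ _ _]setTI; apply: finite_setIr.
  apply: sub_finite_set (finite_setX (finite_stab_orbit x z) (finite_stab_orbit x y)).
  by move=> _ [g Sg <-] /=; split; exists g.
split.
- by move=> _ [g Sg <-] /=; exists g.
- by move=> [u v] [u' v'] _ _ /= [-> ->].
- by move=> _ [g Sg <-] /=; exists (g z, g y) => //; exists g.
Qed.

Local Notation Delta := (modular_function R Gam).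

Lemma modular_functionE x y : Delta x y = (orbit_size y x)%:R / (orbit_size x y)%:R.
Proof. by []. Qed.

Lemma orbit_size_neq0 x y : (orbit_size x y)%:R != 0 :> R.
Proof. by rewrite pnatr_eq0 -lt0n orbit_size_gt0. Qed.

Lemma modular_gt0 x y : 0 < Delta x y.
Proof. by rewrite divr_gt0 // ltr0n orbit_size_gt0. Qed.

Lemma modular_Gam g x y : Gam g -> Delta (g x) (g y) = Delta x y.
Proof. by move=> Gg; rewrite !modular_functionE !orbit_size_Gam. Qed.

(** By [orbit_sizeM] the orbit sizes at [x], [y], [z] satisfy three relations that
involve the orbits of two-point stabilizers; in the product of the three
relations these cancel. *)
Lemma modular_cocycle x y z : Delta x y * Delta y z = Delta x z.
Proof.
rewrite !modular_functionE mulrACA -invfM.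
apply/eqP; rewrite eqr_div ?mulf_neq0 ?orbit_size_neq0 //; apply/eqP.
have hx : (orbit_size x y * orbit2_size x y z)%:R =
    (orbit_size x z * orbit2_size z x y)%:R :> R.
  by rewrite orbit_sizeM (orbit2_sizeC x z).
have hy : (orbit_size y z * orbit2_size y z x)%:R =
    (orbit_size y x * orbit2_size x y z)%:R :> R.
  by rewrite orbit_sizeM (orbit2_sizeC y x).
have hz : (orbit_size z x * orbit2_size z x y)%:R =
    (orbit_size z y * orbit2_size y z x)%:R :> R.
  by rewrite orbit_sizeM (orbit2_sizeC z y).
have t0 : (orbit2_size x y z)%:R * (orbit2_size y z x)%:R *
    (orbit2_size z x y)%:R != 0 :> R.
  by rewrite !mulf_neq0 // pnatr_eq0 -lt0n orbit2_size_gt0.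
apply: (mulIf t0); move: hx hy hz; rewrite !natrM => hx hy hz.
have := congr2 *%R (congr2 *%R hx hy) hz.
lra.
Qed.

(** Only ratios of heights matter, and these are independent of [o]. *)
Definition height (o x : V) : R := Delta o x.

Lemma height_gt0 o x : 0 < height o x.
Proof. exact: modular_gt0. Qed.

Lemma height_ratio o x y : height o y / height o x = Delta x y.
Proof.
by rewrite /height -(modular_cocycle o x y) mulrC mulKf // gt_eqF // modular_gt0.
Qed.

Lemma height_Gam o g x y : Gam g ->
  height o (g x) / height o (g y) = height o x / height o y.
Proof. by move=> Gg; rewrite !height_ratio modular_Gam. Qed.

Section EdgeTransport.
Variable f : V -> V -> R.
Hypothesis f_Gam : forall g u v, Gam g -> f (g u) (g v) = f u v.

Lemma sum_indicator x (A : set V) : A `<=` [set y | e x y] ->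
  \sum_(z <- nb x) `[< A z >]%:R = #|` fset_set A|%:R :> R.
Proof.
move=> Ax; have finA : finite_set A by exact: sub_finite_set (e_locally_finite x).
rewrite -natr_sum -big_mkcond sum1_count -size_filter; congr (_%:R).
apply: perm_size; apply: uniq_perm; rewrite ?filter_uniq ?fset_uniq //.
move=> z; rewrite mem_filter mem_neighbours in_fset_set //.
apply/idP/idP; first by case/andP=> /asboolP Az _; rewrite inE.
by rewrite inE => Az; apply/andP; split; [exact/asboolP|exact: Ax].
Qed.

Let swap_orbit x y y' := exists g, [/\ Gam g, g x = y' & g y = x].

Lemma swap_orbit_targets x y : exists2 y', swap_orbit x y y' &
  [set z | swap_orbit x y z] = stab_orbit Gam x y'.
Proof.
have [h Gh hy] := Gam_transitive y x.
exists (h x); first by exists h.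
have [k [Gk hk kh]] := Gam_inv Gh.
rewrite eqEsubset; split=> [z [g [Gg gx gy]]|_ [g [Gg gx] <-]] /=.
  exists (g \o k); last by rewrite /= hk.
  by split; [exact: Gam_comp|rewrite /= -hy hk gy].
by exists (g \o h); split; [exact: Gam_comp| |rewrite /= hy gx].
Qed.

Lemma swap_orbit_sources x y' : exists2 y, swap_orbit x y y' &
  [set z | swap_orbit x z y'] = stab_orbit Gam x y /\ orbit_size x y = orbit_size y' x.
Proof.
have [h Gh hy] := Gam_transitive y' x.
have [k [Gk hk kh]] := Gam_inv Gh.
exists (h x); first by exists k; split=> //; rewrite -hy hk.
split; last by rewrite -{1}hy orbit_size_Gam.
rewrite eqEsubset; split=> [z [g [Gg gx gz]]|_ [g [Gg gx] <-]] /=.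
  have [l [Gl gl lg]] := Gam_inv Gg.
  exists (l \o k); last by rewrite /= hk -gz gl.
  by split; [exact: Gam_comp|rewrite /= -{1}hy hk -gx gl].
have [l [Gl gl lg]] := Gam_inv Gg.
exists (k \o l); split; first exact: Gam_comp.
  by rewrite /= -{1}gx gl -hy hk.
by rewrite /= gl hk.
Qed.

(** Spread [f x y] evenly over the [y'] such that [(y', x)] is in the orbit of
[(x, y)]: they form an orbit of the stabilizer of [x], on which [f y' x] equals
[f x y]. Each [y'] then receives as many shares as there are such [y], and the
ratio of the two orbit sizes is the modular function. *)
Lemma modular_edge_transport x :
  \sum_(y <- nb x) f x y = \sum_(y <- nb x) Delta x y * f y x.
Proof.
have es : symmetric e by case: e_simple.
have adj y y' : swap_orbit x y y' -> e x y -> e x y'.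
  by move=> [g [Gg gx gy]]; rewrite -(Gam_adj x y Gg) gx gy es.
pose w y y' : R := `[< swap_orbit x y y' >]%:R.
transitivity (\sum_(y <- nb x) \sum_(y' <- nb x)
    w y y' * (f y' x / (orbit_size x y')%:R)).
  apply: eq_big_seq => y; rewrite mem_neighbours => exy.
  have [y0 [g [Gg gx gy]] E] := swap_orbit_targets x y.
  transitivity (\sum_(y' <- nb x) w y y' * (f x y / (orbit_size x y0)%:R)).
    rewrite -mulr_suml /w (sum_indicator (A := [set z | swap_orbit x y z])).
      by rewrite E mulrC divfK // orbit_size_neq0.
    by move=> z /adj; apply.
  apply: eq_bigr => y' _; rewrite /w; case: asboolP => [my|]; last by rewrite !mul0r.
  have [h [Gh hx hy]] := my.
  have -> : f y' x = f x y by rewrite -(f_Gam x y Gh) hx hy.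
  have : stab_orbit Gam x y0 y' by rewrite -E.
  move=> [k [Gk kx] <-]; by rewrite -[in orbit_size x (k _)]kx orbit_size_Gam.
rewrite exchange_big /=; apply: eq_big_seq => y'; rewrite mem_neighbours => exy'.
rewrite -mulr_suml /w; have [y My [E sz]] := swap_orbit_sources x y'.
rewrite (sum_indicator (A := [set z | swap_orbit x z y'])).
  by rewrite E -/(orbit_size x y) sz modular_functionE mulrA [LHS]mulrAC.
move=> z [g [Gg gx gz]] /=.
by rewrite -(Gam_adj x z Gg) gx gz es.
Qed.

End EdgeTransport.

Lemma height_edge_transport o (f : V -> V -> R) x :
  (forall g u v, Gam g -> f (g u) (g v) = f u v) ->
  \sum_(y <- nb x) f x y = \sum_(y <- nb x) height o y / height o x * f y x.
Proof.
move=> f_Gam; rewrite modular_edge_transport //.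
by apply: eq_bigr => y _; rewrite height_ratio.
Qed.

End Modular.

(** * Bridges and half-space walks *)

Section Shapes.
Variables (R : realType) (V : choiceType).
Implicit Types (h : V -> R) (x v : V) (s : seq V).

(** The shapes take the height as an argument, because upward walks are downward
walks for the inverse height. *)
Definition half h x s := uniq (x :: s) && all (fun v => h v < h x) s.

Definition weak_half h x s := uniq (x :: s) && all (fun v => h v <= h x) s.

Definition bridge h x s := half h x s && all (fun v => h (last x s) <= h v) s.

Definition weak_bridge h x s :=
  uniq (x :: s) && all (fun v => h (last x s) <= h v <= h x) (x :: s).

(** The reversal of a walk that stays weakly below its start. *)
Definition peak h x s := uniq (x :: s) && all (fun v => h v <= h (last x s)) (x :: s).

(** Half-space walks whose span, the ratio of their extreme heights, is below [t]. *)
Definition half_lt h t x s := half h x s && all (fun v => h x < t * h v) s.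

Lemma uniq_split k x s : uniq (x :: s) ->
  uniq (x :: take k s) && uniq (last x (take k s) :: drop k s).
Proof.
rewrite -{1}(cat_take_drop k s) -cat_cons cat_uniq => /and3P[-> nd ud] /=.
rewrite ud andbT; apply/negP => ld; move/hasPn: nd => /(_ _ ld).
by rewrite mem_last.
Qed.

Lemma last_max h x s : exists2 k, (k <= size s)%N &
  all (fun v => h v <= h (last x (take k s))) (x :: take k s) &&
  all (fun v => h v < h (last x (take k s))) (drop k s).
Proof.
elim: s x => [|y s IH] x; first by exists 0%N => //=; rewrite lexx.
have [k ks] := IH y; set M := last y _ => /andP[tk dr].
case: (leP (h x) (h M)) => xM.
  by exists k.+1 => //=; rewrite -/M xM dr andbT.
exists 0%N => //; rewrite drop0 take0 [last _ _]/= [all _ [:: x]]/= lexx /=.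
have : all (fun v => h v < h x) (y :: s).
  rewrite -(cat_take_drop k s) -cat_cons all_cat; apply/andP; split.
    by apply: sub_all tk => v /le_lt_trans; apply.
  by apply: sub_all dr => v /lt_trans; apply.
by [].
Qed.

(** The cut is at the last visit to a highest point: only the last one leaves a
strict inequality behind it. *)
Lemma cut_at_max h x s : uniq (x :: s) -> exists2 k, (k <= size s)%N &
  peak h x (take k s) && half h (last x (take k s)) (drop k s).
Proof.
move=> us; have [k ks /andP[tk dr]] := last_max h x s.
by have /andP[u1 u2] := uniq_split k us; exists k => //; rewrite /peak /half u1 u2 tk dr.
Qed.

Variable h : V -> R.
Hypothesis h_gt0 : forall x, 0 < h x.
Local Notation hV := (fun v => (h v)^-1).

Lemma ltV x y : (hV x < hV y) = (h y < h x).
Proof. by rewrite ltf_pV2 ?posrE. Qed.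

Lemma leV x y : (hV x <= hV y) = (h y <= h x).
Proof. by rewrite lef_pV2 ?posrE. Qed.

(** The cut is at the last visit to a lowest point, after which the walk is a
half-space walk for the inverse height. *)
Lemma cut_at_min x s : half h x s -> exists2 k, (k <= size s)%N &
  [&& (s != [::]) ==> (0 < k)%N, bridge h x (take k s) &
      half hV (last x (take k s)) (drop k s)].
Proof.
move=> /andP[us hs]; have [k ks /andP[/andP[uk pk] hk]] := cut_at_max hV us.
exists k => //; rewrite hk andbT; apply/andP; split.
  apply/implyP; case: s us hs ks uk pk hk => // y s _ /andP[yx _] _ _ _.
  case: k => // /andP[_] /=; rewrite ltV => /andP[xy _].
  by have := lt_trans xy yx; rewrite ltxx.
have ht : all (fun v => h v < h x) (take k s).
  by move: hs; rewrite -{1}(cat_take_drop k s) all_cat => /andP[].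
rewrite /bridge /half uk ht /=.
by move: pk => /= /andP[_]; apply: sub_all => v; rewrite leV.
Qed.

(** The first bridge stays weakly above the junction and the second one strictly
below it, so the two do not meet. *)
Lemma bridge_cat x s1 s2 : bridge h x s1 -> bridge h (last x s1) s2 ->
  bridge h x (s1 ++ s2).
Proof.
move=> /andP[/andP[u1 h1] l1] /andP[/andP[u2 h2] l2].
have l1x : h (last x s1) <= h x.
  case/lastP: s1 h1 {u1 l1 u2 h2 l2} => [|s z] //.
  by rewrite last_rcons all_rcons => /andP[/ltW].
have h2x : all (fun v => h v < h x) s2.
  by apply: sub_all h2 => v /lt_le_trans; apply.
have ll : h (last x (s1 ++ s2)) <= h (last x s1).
  rewrite last_cat; case/lastP: s2 h2 {u2 l2 h2x} => [|s z] //.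
  by rewrite last_rcons all_rcons => /andP[/ltW].
have nh : ~~ has (mem (x :: s1)) s2.
  rewrite -all_predC; apply/allP => v vs2; have := allP h2 _ vs2.
  apply: contraTN; rewrite inE => /orP[/eqP ->|vs1]; rewrite -leNgt //.
  exact: (allP l1).
have us2 : uniq s2 by case/andP: u2.
have ls1 : all (fun v => h (last x (s1 ++ s2)) <= h v) s1.
  by apply: sub_all l1 => v; exact: le_trans.
rewrite /bridge /half -cat_cons cat_uniq u1 !all_cat h1 h2x nh us2 ls1 /=.
by rewrite last_cat.
Qed.

Lemma weak_bridge_rev x s :
  weak_bridge hV (last x s) (rev (belast x s)) = weak_bridge h x s.
Proof.
have E : last x s :: rev (belast x s) = rev (x :: s) by rewrite (lastI x s) rev_rcons.
rewrite /weak_bridge E rev_uniq all_rev; congr andb.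
have -> : last (last x s) (rev (belast x s)) = x.
  by case: s E => [|y s] //= _; rewrite rev_cons last_rcons.
by apply: eq_all => v; rewrite !leV andbC.
Qed.

End Shapes.

(** * Summability of tilted bridges *)

Section Core.
Variables (R : realType) (V : choiceType) (nb : V -> seq V).
Variables (Gam : set (V -> V)) (m : V -> R) (o : V).
Hypothesis nb_uniq : forall x, uniq (nb x).
Hypothesis Gam_inj : forall g, Gam g -> injective g.
Hypothesis nb_Gam : forall g x, Gam g -> nb (g x) =i map g (nb x).
Hypothesis Gam_transitive : transitive_action Gam.
Hypothesis m_gt0 : forall x, 0 < m x.
Hypothesis m_Gam : forall g x y, Gam g -> m (g x) / m (g y) = m x / m y.
Hypothesis edge_mass_transport : forall (f : V -> V -> R) x,
  (forall g u v, Gam g -> f (g u) (g v) = f u v) ->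
  \sum_(y <- nb x) f x y = \sum_(y <- nb x) m y / m x * f y x.
Variables (rise fall : R).
Hypothesis higher : forall x, exists u, [/\ x \in nb u, m x < m u & m u = rise * m x].
Hypothesis fall_ge0 : 0 <= fall.
Hypothesis fall_lt1 : fall < 1.
Hypothesis lower : forall x y, y \in nb x -> m y < m x -> m y <= fall * m x.

Local Notation wsum := (wsum nb).
Local Notation invariant := (invariant Gam).
Local Notation adj := (fun u v => v \in nb u).

Definition tot n (F : V -> seq V -> R) := wsum n o (F o).

Lemma totE n x F : invariant F -> wsum n x (F x) = tot n F.
Proof.
move=> Finv; have [g Gg <-] := Gam_transitive o x.
exact: (wsum_invariant nb_uniq Gam_inj nb_Gam).
Qed.

Lemma wsum_prod k n x F1 F2 : invariant F2 -> (k <= n)%N ->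
  wsum n x (fun s => F1 (take k s) * F2 (last x (take k s)) (drop k s)) =
  wsum k x F1 * tot (n - k) F2.
Proof.
move=> Finv kn; rewrite (wsum_split _ _ (fun s t => F1 s * F2 (last x s) t)) //.
rewrite -wsumZr; apply: eq_wsum => s _ _.
by rewrite wsumZ totE.
Qed.

(** A height is defined up to a factor, so automorphisms preserve comparisons
between heights rather than heights. *)
Definition scaled (h : V -> R) :=
  forall g, Gam g -> exists2 a, 0 < a & forall v, h (g v) = a * h v.

Lemma m_scaled : scaled m.
Proof.
move=> g Gg; exists (m (g o) / m o); first by rewrite divr_gt0.
move=> v; have := m_Gam v o Gg.
move/(canRL (divfK _)) => ->; last by rewrite gt_eqF.
by rewrite mulrC mulrA mulrAC.
Qed.

Lemma mV_scaled : scaled (fun v => (m v)^-1).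
Proof.
move=> g /m_scaled[a a0 ma]; exists a^-1; first by rewrite invr_gt0.
by move=> v; rewrite ma invfM.
Qed.

Definition shape_invariant (P : V -> seq V -> bool) :=
  forall g x s, Gam g -> P (g x) (map g s) = P x s.

Lemma indicator_invariant P :
  shape_invariant P -> invariant (fun x s => (P x s)%:R : R).
Proof. by move=> Pi g x s Gg; rewrite Pi. Qed.

Lemma uniq_map_Gam g x s : Gam g -> uniq (g x :: map g s) = uniq (x :: s).
Proof. by move=> Gg; rewrite -map_cons map_inj_uniq //; exact: Gam_inj. Qed.

Lemma half_invariant h : scaled h -> shape_invariant (half h).
Proof.
move=> hs g x s Gg; have [a a0 ha] := hs g Gg.
rewrite /half uniq_map_Gam // all_map; congr andb; apply: eq_all => v /=.
by rewrite !ha ltr_pM2l.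
Qed.

Lemma half_lt_invariant h t : scaled h -> shape_invariant (half_lt h t).
Proof.
move=> hs g x s Gg; have [a a0 ha] := hs g Gg.
rewrite /half_lt half_invariant // all_map; congr andb; apply: eq_all => v /=.
by rewrite !ha mulrCA ltr_pM2l.
Qed.

Lemma bridge_invariant h : scaled h -> shape_invariant (bridge h).
Proof.
move=> hs g x s Gg; have [a a0 ha] := hs g Gg.
rewrite /bridge half_invariant // all_map last_map; congr andb.
by apply: eq_all => v /=; rewrite !ha ler_pM2l.
Qed.

Lemma weak_bridge_invariant h : scaled h -> shape_invariant (weak_bridge h).
Proof.
move=> hs g x s Gg; have [a a0 ha] := hs g Gg.
rewrite /weak_bridge uniq_map_Gam // -map_cons all_map last_map; congr andb.
by apply: eq_all => v /=; rewrite !ha !ler_pM2l.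
Qed.

Lemma ratio_ge0 x y : 0 <= m y / m x.
Proof. by rewrite divr_ge0 // ltW. Qed.

(** The exponent one half is the one for which upward and downward bridges weigh
the same, see [tilt_rev]. *)
Definition tilt x y : R := Num.sqrt (m y / m x).

Lemma tilt_ge0 x y : 0 <= tilt x y. Proof. exact: sqrtr_ge0. Qed.

Lemma tiltxx x : tilt x x = 1.
Proof. by rewrite /tilt divff ?sqrtr1 // gt_eqF. Qed.

Lemma tilt_cocycle x y w : tilt x y * tilt y w = tilt x w.
Proof.
rewrite /tilt -sqrtrM; last exact: ratio_ge0.
by rewrite mulrC mulrA divfK // gt_eqF.
Qed.

Lemma tilt_Gam g x y : Gam g -> tilt (g x) (g y) = tilt x y.
Proof. by move=> Gg; rewrite /tilt m_Gam. Qed.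

Lemma tilt_rev x y : m y / m x * tilt y x = tilt x y.
Proof.
rewrite -[m y / m x]sqr_sqrtr; last exact: ratio_ge0.
by rewrite expr2 -mulrA -/(tilt x y) tilt_cocycle tiltxx mulr1.
Qed.

Lemma tilt_le1 x y : m y <= m x -> tilt x y <= 1.
Proof. by move=> yx; rewrite -sqrtr1 ler_sqrt // ler_pdivrMr // mul1r. Qed.

Lemma tilt_ge1 x y : m x <= m y -> 1 <= tilt x y.
Proof. by move=> xy; rewrite -sqrtr1 ler_sqrt ?ratio_ge0 // ler_pdivlMr // mul1r. Qed.

Lemma le_tilt x y : m y <= m x -> m y / m x <= tilt x y.
Proof.
move=> yx; rewrite -[leLHS]sqr_sqrtr; last exact: ratio_ge0.
rewrite expr2 -[leRHS]mul1r ler_wpM2r ?tilt_ge0 //; exact: tilt_le1.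
Qed.

Definition tilted (P : V -> seq V -> bool) x s : R := tilt x (last x s) * (P x s)%:R.

Lemma tilted_ge0 P x s : 0 <= tilted P x s.
Proof. by rewrite mulr_ge0 ?tilt_ge0. Qed.

Lemma tilted_invariant P : shape_invariant P -> invariant (tilted P).
Proof. by move=> Pi g x s Gg; rewrite /tilted last_map tilt_Gam // Pi. Qed.

(** ** Cut points *)

Definition cut_bound : R := (1 - Num.sqrt fall)^-1.

Lemma cut_bound_gt0 : 0 < cut_bound.
Proof. by rewrite invr_gt0 subr_gt0 -sqrtr1 ltr_sqrt. Qed.

Let is_cut a x s k := [&& m (last x (take k s)) <= a,
  all (fun v => m (last x (take k s)) <= m v) (x :: take k s) &
  all (fun v => m v < m (last x (take k s))) (drop k s)].

(** The step that leaves a cut point descends, hence by the factor [fall], and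
later cut points are lower still: the square roots of their heights are dominated
by a geometric progression. The bound [a] on the heights is what the induction
along the walk lowers. *)
Lemma cut_sum_le a x s : 0 < a -> path adj x s ->
  \sum_(k < (size s).+1) (is_cut a x s k)%:R * Num.sqrt (m (last x (take k s))) <=
  cut_bound * Num.sqrt a.
Proof.
have K0 := cut_bound_gt0.
have Kc : 1 + cut_bound * Num.sqrt fall = cut_bound.
  rewrite /cut_bound; set c := Num.sqrt fall.
  have c1 : 1 - c != 0 by rewrite gt_eqF // -invr_gt0.
  by rewrite -{1}(mulVf c1) -mulrDr subrK mulr1.
elim: s a x => [|y s IH] a x a0.
  move=> _; rewrite big_ord_recl big_ord0 addr0 /is_cut /= lexx /= !andbT.
  case: (leP (m x) a) => xa; last by rewrite mul0r mulr_ge0 ?sqrtr_ge0 ?ltW.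
  rewrite mul1r; apply: (@le_trans _ _ (Num.sqrt a)); first by rewrite ler_sqrt // ltW.
  rewrite -[leLHS]mul1r ler_wpM2r ?sqrtr_ge0 // -Kc lerDl mulr_ge0 ?sqrtr_ge0 //.
  exact: ltW.
move=> /= /andP[yx ps]; rewrite big_ord_recl /= {1}/is_cut /= lexx /=.
have tail b : (forall k, is_cut a x (y :: s) k.+1 -> m (last y (take k s)) <= b) ->
    \sum_(i < (size s).+1) (is_cut a x (y :: s) i.+1)%:R *
      Num.sqrt (m (last y (take i s))) <=
    \sum_(k < (size s).+1) (is_cut b y s k)%:R * Num.sqrt (m (last y (take k s))).
  move=> cb; apply: ler_sum => k _; rewrite ler_wpM2r ?sqrtr_ge0 // ler_nat.
  case E: (is_cut a x _ _) => //; rewrite lt0b /is_cut cb //.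
  by move: E; rewrite /is_cut /= => /and3P[_ /andP[_ ->] ->].
(* If the start is no cut point, the bound [a] passes on; if it is one, the height
   of the next point becomes the bound. *)
case: and3P => [[xa yx' sx]|_]; last first.
  rewrite mul0r add0r; apply: le_trans (tail a _) (IH _ _ a0 ps).
  by move=> k /and3P[].
have yfall := lower yx yx'.
rewrite mul1r; apply: (@le_trans _ _ (cut_bound * Num.sqrt (m x))); last first.
  by rewrite ler_wpM2l ?ler_sqrt ?(ltW K0) // ltW.
rewrite -[in leRHS]Kc mulrDl mul1r lerD2l.
apply: le_trans (tail (m y) _) _.
  by move=> k /and3P[_ /and3P[]].
apply: le_trans (IH _ _ (m_gt0 y) ps) _.
rewrite -mulrA -sqrtrM // ler_wpM2l ?(ltW K0) // ler_sqrt //.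
by rewrite mulr_ge0 // ltW.
Qed.

Lemma bridge_cut_sum_le x s : path adj x s ->
  \sum_(k < (size s).+1) tilted (bridge m) x (take k s) *
     (bridge m (last x (take k s)) (drop k s))%:R <=
  cut_bound * (bridge m x s)%:R.
Proof.
move=> ps; case bs: (bridge m x s); last first.
  rewrite mulr0 big1 // => k _; rewrite /tilted.
  case b1: (bridge m x _); last by rewrite mulr0 mul0r.
  case b2: (bridge m _ _); last by rewrite mulr0.
  by have := bridge_cat b1 b2; rewrite cat_take_drop bs.
have sx0 : 0 < Num.sqrt (m x) by rewrite sqrtr_gt0.
rewrite mulr1 -(ler_pM2r sx0); apply: le_trans (cut_sum_le (m_gt0 x) ps).
rewrite mulr_suml; apply: ler_sum => k _.
have tE y : tilt x y * Num.sqrt (m x) = Num.sqrt (m y).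
  by rewrite /tilt -sqrtrM ?divfK // ?gt_eqF // divr_ge0 // ltW.
rewrite /tilted; case b1: (bridge m x _); last first.
  by rewrite mulr0 !mul0r mulr_ge0 ?sqrtr_ge0.
case b2: (bridge m _ _); last by rewrite mulr0 mul0r mulr_ge0 ?sqrtr_ge0.
rewrite !mulr1 tE -[leLHS]mul1r ler_wpM2r ?sqrtr_ge0 // ler1n lt0b.
move: b1 b2 => /andP[/andP[_ h1] l1] /andP[/andP[_ h2] _].
suff lx : m (last x (take k s)) <= m x by rewrite /is_cut lx h2 /= lx l1.
case/lastP: (take k s) h1 => [|t z] //.
by rewrite last_rcons all_rcons => /andP[/ltW].
Qed.

Definition bridge_count n : R := tot n (fun x s => (bridge m x s)%:R).

Lemma bridge_count0 : bridge_count 0 = 1.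
Proof. by rewrite /bridge_count /tot wsum0. Qed.

(** A step down is a bridge; it is provided by a neighbour above some vertex. *)
Lemma bridge_count1_ge1 : 1 <= bridge_count 1.
Proof.
have [u [ou omu _]] := higher o.
rewrite /bridge_count -(totE 1 u); last exact/indicator_invariant/bridge_invariant/m_scaled.
rewrite wsumS (bigD1_seq o) ?nb_uniq //= wsum0 /bridge /half /= omu lexx inE.
rewrite (_ : u == o = false) ?andbT /=; last by apply/negP => /eqP uo; rewrite uo ltxx in omu.
by rewrite lerDl sumr_ge0 // => y _; exact: wsum_ge0.
Qed.

Lemma bridge_count_supermul k l :
  bridge_count k * bridge_count l <= bridge_count (k + l).
Proof.
have := wsum_prod o (fun s => (bridge m o s)%:R)
  (indicator_invariant (bridge_invariant m_scaled)) (leq_addr l k).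
rewrite addKn => <-; apply: ler_wsum => s _ _.
case b1: (bridge m o (take k s)); last by rewrite mul0r.
case b2: (bridge m _ _); last by rewrite mulr0.
by have := bridge_cat b1 b2; rewrite cat_take_drop => ->; rewrite mulr1.
Qed.

Definition saw_count n : R := tot n (fun x s => (uniq (x :: s))%:R).

Lemma saw_count_submul k l : saw_count (k + l) <= saw_count k * saw_count l.
Proof.
have saw_inv : invariant (fun x s => (uniq (x :: s))%:R : R).
  apply: (@indicator_invariant (fun x s => uniq (x :: s))) => g x s Gg.
  exact: uniq_map_Gam.
have := wsum_prod o (fun s => (uniq (o :: s))%:R) saw_inv (leq_addr l k).
rewrite addKn => <-; apply: ler_wsum => s _ _.
case us: (uniq (o :: s)); last by rewrite mulr_ge0.
by have /andP[-> ->] := uniq_split k us; rewrite mulr1.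
Qed.

Lemma bridge_count_exp_le n j : bridge_count n ^+ j <= saw_count (n * j).
Proof.
apply: (@le_trans _ _ (bridge_count (n * j))); last first.
  apply: ler_wsum => s _ _; rewrite ler_nat /bridge /half.
  by case: (uniq _) => //; rewrite leq_b1.
elim: j => [|j IH]; first by rewrite muln0 bridge_count0.
rewrite mulnS exprS; apply: le_trans (bridge_count_supermul _ _).
by rewrite ler_wpM2l //; exact: wsum_ge0.
Qed.

Lemma saw_count_ge1 n : 1 <= saw_count n.
Proof.
rewrite -[n]mul1n; apply: le_trans (bridge_count_exp_le 1 n).
exact/exprn_ege1/bridge_count1_ge1.
Qed.

Section Critical.
Variable mu : R.
Hypothesis mu_gt0 : 0 < mu.
Local Notation z := mu^-1.

Hypothesis bridge_count_le : forall n, bridge_count n <= mu ^+ n.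

Lemma z_gt0 : 0 < z. Proof. by rewrite invr_gt0. Qed.

Lemma zX_ge0 n : 0 <= z ^+ n. Proof. by rewrite exprn_ge0 // ltW // z_gt0. Qed.

Lemma tot_ge0 n F : (forall x s, 0 <= F x s) -> 0 <= tot n F.
Proof. by move=> F0; exact: wsum_ge0. Qed.

(** Each bridge of length [n] is cut in two at its cut points, in all ways, which
bounds the convolution of the tilted and plain counts of bridges. *)
Lemma tilted_bridge_sum_le N :
  \sum_(k < N) z ^+ k * tot k (tilted (bridge m)) <= cut_bound.
Proof.
apply: (@renewal_sum_le _ (fun k => z ^+ k * tot k (tilted (bridge m)))
  (fun n => z ^+ n * bridge_count n)).
- exact: cut_bound_gt0.
- move=> k; rewrite mulr_ge0 ?zX_ge0 // tot_ge0 // => x s; exact: tilted_ge0.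
- move=> n; rewrite mulr_ge0 ?zX_ge0 //=; last exact: tot_ge0.
  by rewrite exprVn mulrC ler_pdivrMr ?exprn_gt0 // mul1r.
- by rewrite expr0 mul1r bridge_count0.
move=> n; rewrite mulrCA.
have -> : \sum_(k < n.+1) z ^+ k * tot k (tilted (bridge m)) *
    (z ^+ (n - k) * bridge_count (n - k)) =
  z ^+ n * wsum n o (fun s => \sum_(k < n.+1) tilted (bridge m) o (take k s) *
     (bridge m (last o (take k s)) (drop k s))%:R).
  rewrite wsum_sum mulr_sumr; apply: eq_bigr => k _.
  rewrite (wsum_prod _ (tilted (bridge m) o) (F2 := fun x s => (bridge m x s)%:R)).
  - by rewrite mulrACA -exprD subnKC // -ltnS.
  - exact/indicator_invariant/bridge_invariant/m_scaled.
  - by rewrite -ltnS.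
rewrite ler_wpM2l ?zX_ge0 // -wsumZ; apply: ler_wsum => s sn ps.
by rewrite -sn; exact: bridge_cut_sum_le.
Qed.

(** Prepending a step from a higher neighbour makes a weak inequality at the
start strict. *)
Lemma prepend_higher_le n (P Q : V -> seq V -> bool) : shape_invariant Q ->
  (forall x u s, m x < m u -> P x s -> Q u (x :: s)) ->
  tot n (tilted P) <= Num.sqrt rise * tot n.+1 (tilted Q).
Proof.
move=> Qinv PQ; have [u [ou omu um]] := higher o.
have ur : tilt o u = Num.sqrt rise by rewrite /tilt um mulfK // gt_eqF.
rewrite -(totE n.+1 u (tilted_invariant Qinv)) wsumS (bigD1_seq o) ?nb_uniq //=.
rewrite mulrDr -[leLHS]addr0; apply: lerD; last first.
  rewrite mulr_ge0 ?sqrtr_ge0 // sumr_ge0 // => y _.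
  by apply: wsum_ge0 => s; exact: tilted_ge0.
rewrite -wsumZ; apply: ler_wsum => s _ _.
rewrite /tilted /= mulrA -ur tilt_cocycle ler_wpM2l ?tilt_ge0 // ler_nat.
by case Ps: (P o s) => //; rewrite lt0b (PQ _ _ _ omu Ps).
Qed.

Lemma prepend_higher_sum_le N (P Q : V -> seq V -> bool) : shape_invariant Q ->
  (forall x u s, m x < m u -> P x s -> Q u (x :: s)) ->
  \sum_(k < N) z ^+ k * tot k (tilted P) <=
  Num.sqrt rise * mu * \sum_(k < N.+1) z ^+ k * tot k (tilted Q).
Proof.
move=> Qinv PQ; rewrite big_ord_recl mulrDr -[leLHS]add0r; apply: lerD.
  rewrite !mulr_ge0 ?sqrtr_ge0 ?zX_ge0 ?(ltW mu_gt0) // tot_ge0 // => x s.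
  exact: tilted_ge0.
rewrite mulr_sumr; apply: ler_sum => k _; rewrite /= exprS.
have := ler_wpM2l (zX_ge0 k) (prepend_higher_le k Qinv PQ).
move/le_trans; apply; set T := tot _ _.
have -> : Num.sqrt rise * mu * (z * z ^+ k * T) =
    mu * z * (z ^+ k * (Num.sqrt rise * T)) by lra.
by rewrite divff ?mul1r // gt_eqF.
Qed.

Lemma prepend_higher_uniq x u s : m x < m u -> uniq (x :: s) ->
  all (fun v => m v <= m x) s -> uniq (u :: x :: s) && all (fun v => m v < m u) (x :: s).
Proof.
move=> xu us ws.
have hs : all (fun v => m v < m u) (x :: s).
  by rewrite /= xu; apply: sub_all ws => v /le_lt_trans; apply.
rewrite hs cons_uniq us !andbT; apply: contraT; rewrite negbK => /(allP hs).
by rewrite ltxx.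
Qed.

(** Weak bridges serve because their reversals are weak bridges for the inverse
height, while bridges are not stable under reversal. *)
Lemma weak_bridge_sum_le N :
  \sum_(k < N) z ^+ k * tot k (tilted (weak_bridge m)) <=
  Num.sqrt rise * mu * cut_bound.
Proof.
apply: le_trans (prepend_higher_sum_le N (Q := bridge m) _ _) _.
- exact/bridge_invariant/m_scaled.
- move=> x u s xu /andP[us ws].
  have hs : all (fun v => m v <= m x) s.
    by case/andP: ws => _; apply: sub_all => v /andP[].
  rewrite /bridge /half prepend_higher_uniq //=.
  by apply: sub_all ws => v /andP[].
by rewrite ler_wpM2l ?tilted_bridge_sum_le // mulr_ge0 ?sqrtr_ge0 // ltW.
Qed.

(** * Tilted half-space walks *)

Local Notation mV := (fun v => (m v)^-1).

Definition span_lt_bridge (h : V -> R) (t : R) (x : V) (s : seq V) :=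
  [&& s != [::], weak_bridge h x s & h x < t * h (last x s)].

Definition bridge_sum N t : R :=
  \sum_(k < N) z ^+ k * tot k (tilted (span_lt_bridge m t)).

Definition half_sum (h : V -> R) N t : R :=
  \sum_(n < N) z ^+ n * tot n (tilted (half_lt h t)).

(** The first bridge of a half-space walk has ratio [h x / h (last x _)], and the
rest of the walk has a smaller span since it stays strictly below [x]. *)
Lemma cut_half_lt h t x s : (forall v, 0 < h v) -> s != [::] -> half_lt h t x s ->
  exists2 k, (k <= size s)%N &
  span_lt_bridge h t x (take k s) &&
  half_lt (fun v => (h v)^-1) (h x / h (last x (take k s)))
    (last x (take k s)) (drop k s).
Proof.
move=> h0 s0 /andP[hs hl].
have [k ks] := cut_at_min h0 hs; rewrite s0 /= => /and3P[k0 bk dk].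
have /andP[/andP[uk hk] lk] := bk.
have tk0 : take k s != [::] by rewrite -size_eq0 size_take_min (minn_idPl ks) -lt0n.
exists k => //; apply/andP; split.
  rewrite /span_lt_bridge tk0 /weak_bridge uk /=.
  have lx : last x (take k s) \in take k s.
    by case: (take k s) tk0 => // y r _; rewrite [last _ _]/= mem_last.
  rewrite (ltW (allP hk _ lx)) !lexx /= (allP hl) ?(mem_take lx) // andbT.
  by apply/allP => v vk; rewrite (allP lk) //= ltW // (allP hk).
rewrite /half_lt dk /=.
have hd : all (fun v => h v < h x) (drop k s).
  by case/andP: hs => _; rewrite -{1}(cat_take_drop k s) all_cat => /andP[].
apply: sub_all hd => v vx.
by rewrite mulrAC -[ltLHS]mul1r ltr_pM2r ?invr_gt0 // ltr_pdivlMr // mul1r.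
Qed.

Lemma span_lt_bridge_invariant h t : scaled h -> shape_invariant (span_lt_bridge h t).
Proof.
move=> hs g x s Gg; have [a a0 ha] := hs g Gg.
rewrite /span_lt_bridge weak_bridge_invariant // last_map !ha mulrCA ltr_pM2l //.
by case: s.
Qed.

Lemma half_sum_step h N t : (forall v, 0 < h v) -> scaled h ->
  half_sum h N t <= 1 + \sum_(k < N) z ^+ k *
    wsum k o (fun s => tilted (span_lt_bridge h t) o s *
      half_sum (fun v => (h v)^-1) (N - k) (h o / h (last o s))).
Proof.
move=> h0 hs; pose hV v := (h v)^-1.
have hVs : scaled hV.
  move=> g /hs[a a0 ha]; exists a^-1; first by rewrite invr_gt0.
  by move=> v; rewrite /hV ha invfM.
pose r s := h o / h (last o s).
have point s : tilted (half_lt h t) o s <= (s == [::])%:R +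
    \sum_(k < (size s).+1) tilted (span_lt_bridge h t) o (take k s) *
      tilted (half_lt hV (r (take k s))) (last o (take k s)) (drop k s).
  have sum0 : 0 <= \sum_(k < (size s).+1) tilted (span_lt_bridge h t) o (take k s) *
      tilted (half_lt hV (r (take k s))) (last o (take k s)) (drop k s).
    by apply: sumr_ge0 => k _; rewrite mulr_ge0 ?tilted_ge0.
  case: (eqVneq s [::]) sum0 => [-> sum0|s0 sum0].
    by rewrite {1}/tilted /half_lt /half /= tiltxx mulr1 lerDl.
  rewrite add0r {1}/tilted; case hl: (half_lt h t o s); last by rewrite mulr0.
  have [k ks /andP[bk hk]] := cut_half_lt h0 s0 hl.
  rewrite (bigD1 (inord k)) //= inordK // -[leLHS]addr0; apply: lerD.
    rewrite /tilted bk hk !mulr1 tilt_cocycle -last_cat cat_take_drop //.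
  by apply: sumr_ge0 => j _; rewrite mulr_ge0 ?tilted_ge0.
have tn n : (n < N)%N -> tot n (tilted (half_lt h t)) <= (n == 0)%:R +
    \sum_(k < n.+1) wsum k o (fun s => tilted (span_lt_bridge h t) o s *
      tot (n - k) (tilted (half_lt hV (r s)))).
  move=> _; rewrite /tot.
  apply: (@le_trans _ _ (wsum n o (fun s => (s == [::])%:R +
    \sum_(k < n.+1) tilted (span_lt_bridge h t) o (take k s) *
      tilted (half_lt hV (r (take k s))) (last o (take k s)) (drop k s)))).
    by apply: ler_wsum => s sn _; rewrite -sn.
  rewrite /wsum big_split /= -!/(wsum _ _ _) wsum_sum; apply: lerD.
    case: n => [|n]; first by rewrite wsum0.
    apply: (@le_trans _ _ (wsum n.+1 o (fun=> 0))); last by rewrite /wsum big1.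
    by apply: ler_wsum => -[].
  apply: ler_sum => k _.
  rewrite (wsum_split _ _ (fun s u => tilted (span_lt_bridge h t) o s *
     tilted (half_lt hV (r s)) (last o s) u)); last by rewrite -ltnS.
  apply: ler_wsum => s _ _; rewrite wsumZ totE //.
  exact/tilted_invariant/half_lt_invariant.
pose A k l := z ^+ k * z ^+ l * wsum k o (fun s =>
  tilted (span_lt_bridge h t) o s * tot l (tilted (half_lt hV (r s)))).
apply: (@le_trans _ _ (\sum_(n < N) (z ^+ n * (n == 0 :> nat)%:R +
    \sum_(k < n.+1) A k (n - k)%N))).
  apply: ler_sum => n _; apply: le_trans (ler_wpM2l (zX_ge0 n) (tn n _)) _ => //.
  rewrite mulrDr lerD2l mulr_sumr; apply: ler_sum => k _.
  by rewrite /A -exprD subnKC // -ltnS.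
rewrite big_split /= triangle_sum; apply: lerD.
  case: N tn => [|N] _; first by rewrite big_ord0.
  by rewrite big_ord_recl /= expr0 mulr1 big1 ?addr0 // => k _; rewrite mulr0.
rewrite le_eqVlt; apply/orP; left; apply/eqP.
apply: eq_bigr => k _; rewrite /half_sum /A.
under eq_bigr => l _ do rewrite -mulrA -wsumZ.
rewrite -mulr_sumr -wsum_sum; congr (_ * _).
apply: eq_wsum => s _ _; rewrite mulr_sumr; apply: eq_bigr => l _.
by rewrite mulrCA.
Qed.

Lemma z_wsum_seq N F :
  \sum_(k < N) z ^+ k * wsum k o F =
  \sum_(s <- flatten [seq walks nb k o | k <- iota 0 N]) z ^+ size s * F s.
Proof.
rewrite big_flatten big_map -[X in iota 0 X]subn0 -/(index_iota 0 N) big_mkord.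
apply: eq_bigr => k _; rewrite -wsumZ; apply: eq_big_seq => s.
by rewrite mem_walks => /andP[/eqP ->].
Qed.

Definition bridge_weight s :=
  z ^+ size s * tilted (fun x s => (s != [::]) && weak_bridge m x s) o s.

Lemma bridge_weight_ge0 s : 0 <= bridge_weight s.
Proof. by rewrite mulr_ge0 ?zX_ge0 ?tilted_ge0. Qed.

Lemma span_lt_bridge_sum N t (G : R -> R) :
  \sum_(k < N) z ^+ k * wsum k o (fun s => tilted (span_lt_bridge m t) o s *
     G (m o / m (last o s))) =
  \sum_(s <- flatten [seq walks nb k o | k <- iota 0 N] | m o / m (last o s) < t)
     bridge_weight s * G (m o / m (last o s)).
Proof.
rewrite z_wsum_seq [RHS]big_mkcond /=; apply: eq_bigr => s _.
rewrite /bridge_weight /tilted /span_lt_bridge ltr_pdivrMr //.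
by case: ifP => tt; rewrite ?andbT ?andbF ?mulr0 ?mul0r ?mulr0 // !mulrA.
Qed.

Lemma bridge_sumE N t : bridge_sum N t =
  \sum_(s <- flatten [seq walks nb k o | k <- iota 0 N] | m o / m (last o s) < t)
     bridge_weight s.
Proof.
have := span_lt_bridge_sum N t (fun=> 1).
under eq_bigr => k _ do rewrite wsumZr mulr1.
move=> sumE; rewrite [LHS]sumE; apply: eq_bigr => s _; by rewrite mulr1.
Qed.

Lemma bridge_sum_mono M N t : (M <= N)%N -> bridge_sum M t <= bridge_sum N t.
Proof.
move=> MN; apply: (@ler_sum_prefix _ (fun k => z ^+ k * tot k _)) => // k.
by rewrite mulr_ge0 ?zX_ge0 // tot_ge0 // => x s; exact: tilted_ge0.
Qed.

(** Reversing turns an upward bridge into a downward one of the same span, and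
the half tilt is exactly what makes their weights agree. *)
Lemma up_bridge_sum k t (G : R -> R) :
  wsum k o (fun s => tilted (span_lt_bridge mV t) o s * G (mV o / mV (last o s))) =
  wsum k o (fun s => tilted (span_lt_bridge m t) o s * G (m o / m (last o s))).
Proof.
pose F x s := tilted (span_lt_bridge mV t) x s * G (mV x / mV (last x s)).
rewrite (@wsum_rev _ _ _ _ nb_uniq Gam_inj nb_Gam _ m_gt0 m_Gam
  edge_mass_transport k o F).
  apply: eq_wsum => s _ _; rewrite /F.
  have lr : last (last o s) (rev (belast o s)) = o.
    by case: s => [|y s] //=; rewrite rev_cons last_rcons.
  rewrite /tilted lr mulrA [X in X * G _]mulrA tilt_rev invrK [_^-1 * m o]mulrC.
  congr (_ * _%:R * _); rewrite /span_lt_bridge weak_bridge_rev // lr.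
  congr andb.
    by rewrite -!size_eq0 size_rev size_belast.
  congr andb; rewrite ltr_pdivlMr // mulrC ltr_pdivrMr //.
move=> g x s Gg; rewrite /F tilted_invariant //; last first.
  exact/span_lt_bridge_invariant/mV_scaled.
by rewrite last_map !invrK ![_^-1 * _]mulrC m_Gam.
Qed.

(** The Hammersley-Welsh argument, by induction on the number [N] of lengths: after
the first bridge, which is not empty, fewer lengths are left and the span bound
is the span of that bridge. *)
Lemma half_sum_le_exp N t : half_sum m N t <= expR (bridge_sum N t) /\
  half_sum mV N t <= expR (bridge_sum N t).
Proof.
have [n] := ubnP N; elim: n N t => // n IH N t; rewrite ltnS => Nn.
have fin : 1 + \sum_(k < N) z ^+ k * wsum k o (fun s =>
    tilted (span_lt_bridge m t) o s *
    expR (bridge_sum N (m o / m (last o s)))) <= expR (bridge_sum N t).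
  rewrite (span_lt_bridge_sum N t (fun r => expR (bridge_sum N r))) bridge_sumE.
  under eq_bigr do rewrite bridge_sumE.
  apply: sum_decreasing_le_exp; exact: bridge_weight_ge0.
have mVV : (fun v => ((m v)^-1)^-1) = m by apply/funext => v; rewrite invrK.
have step h h' : (forall M u, (M < N)%N -> half_sum h' M u <= expR (bridge_sum M u)) ->
    \sum_(k < N) z ^+ k * wsum k o (fun s =>
      tilted (span_lt_bridge h t) o s * half_sum h' (N - k) (h o / h (last o s))) <=
    \sum_(k < N) z ^+ k * wsum k o (fun s =>
      tilted (span_lt_bridge h t) o s *
      expR (bridge_sum N (h o / h (last o s)))).
  move=> hIH; apply: ler_sum => k _; rewrite ler_wpM2l ?zX_ge0 //.
  apply: ler_wsum => -[|y s] sk _; first by rewrite /tilted /= mulr0 !mul0r.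
  rewrite ler_wpM2l ?tilted_ge0 //; set u := h o / _.
  have lt_k : (N - k < N)%N.
    by rewrite ltn_subrL -sk; apply: leq_ltn_trans (ltn_ord k).
  apply: le_trans (hIH _ u lt_k) _; rewrite ler_expR.
  exact/bridge_sum_mono/leq_subr.
split.
  apply: le_trans (half_sum_step N t m_gt0 m_scaled) _.
  apply: le_trans fin; rewrite lerD2l; apply: step => M u MN.
  by have [] := IH M u (leq_trans MN Nn).
have mV_gt0 v : 0 < (m v)^-1 by rewrite invr_gt0.
apply: le_trans (half_sum_step N t mV_gt0 mV_scaled) _.
rewrite mVV; apply: le_trans fin; rewrite lerD2l.
apply: (le_trans (step mV m _)) => [M u MN|].
  by have [] := IH M u (leq_trans MN Nn).
rewrite le_eqVlt; apply/orP; left; apply/eqP; apply: eq_bigr => k _.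
by rewrite (up_bridge_sum k t (fun r => expR (bridge_sum N r))).
Qed.

Definition half_bound : R := expR (Num.sqrt rise * mu * cut_bound).

Lemma bridge_sum_le N t : bridge_sum N t <= Num.sqrt rise * mu * cut_bound.
Proof.
apply: le_trans (weak_bridge_sum_le N); apply: ler_sum => k _.
rewrite ler_wpM2l ?zX_ge0 //; apply: ler_wsum => s _ _.
rewrite /tilted ler_wpM2l ?tilt_ge0 // ler_nat /span_lt_bridge.
by case: (weak_bridge m o s); rewrite ?andbF ?leq_b1.
Qed.

Lemma ratio_bounded (h : V -> R) (l : seq V) : (forall v, 0 < h v) ->
  exists t, forall v, v \in l -> h o < t * h v.
Proof.
move=> h0; elim: l => [|y l [t tl]]; first by exists 0.
exists (Num.max t (h o / h y + 1)) => v; rewrite inE => /orP[/eqP ->|/tl vt].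
  rewrite -ltr_pdivrMr // lt_max; apply/orP; right; by rewrite ltrDl.
by apply: (lt_le_trans vt); rewrite ler_pM2r // le_max lexx.
Qed.

(** Among finitely many walks every span is below some [t]. *)
Lemma tilted_half_sum_le h N : h = m \/ h = mV ->
  \sum_(n < N) z ^+ n * tot n (tilted (half h)) <= half_bound.
Proof.
move=> hm; have h0 v : 0 < h v by case: hm => ->; rewrite ?invr_gt0.
have [t tP] := ratio_bounded
  (flatten (flatten [seq walks nb k o | k <- iota 0 N])) h0.
apply: (@le_trans _ _ (half_sum h N t)).
  apply: ler_sum => n _; rewrite ler_wpM2l ?zX_ge0 //; apply: ler_wsum => s sn ps.
  rewrite /tilted ler_wpM2l ?tilt_ge0 // ler_nat /half_lt.
  case: (half h o s) => //=; rewrite lt0b; apply/allP => v vs; apply: tP.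
  apply/flattenP; exists s => //; apply/flattenP; exists (walks nb n o).
    by apply/mapP; exists (n : nat); rewrite // mem_iota /=.
  by rewrite mem_walks sn eqxx.
have [lem lemV] := half_sum_le_exp N t.
apply: (@le_trans _ _ (expR (bridge_sum N t))); first by case: hm => ->.
by rewrite ler_expR bridge_sum_le.
Qed.

Lemma tilted_weak_half_sum_le N :
  \sum_(n < N) z ^+ n * tot n (tilted (weak_half m)) <=
  Num.sqrt rise * mu * half_bound.
Proof.
apply: le_trans (prepend_higher_sum_le N (Q := half m) _ _) _.
- exact/half_invariant/m_scaled.
- by move=> x u s xu /andP[us ws]; rewrite /half prepend_higher_uniq.
rewrite ler_wpM2l ?tilted_half_sum_le //; last by left.
by rewrite mulr_ge0 ?sqrtr_ge0 // ltW.
Qed.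

(** * Counting walks *)

(** Cut at the last lowest point: a bridge, counted without tilt, is followed by a
walk above its start, whose tilt is at least [1]. *)
Lemma half_count_le n :
  z ^+ n * tot n (fun x s => (half m x s)%:R) <= half_bound.
Proof.
have le1 : tot n (fun x s => (half m x s)%:R) <=
    \sum_(k < n.+1) bridge_count k * tot (n - k) (tilted (half mV)).
  rewrite /tot; have -> : \sum_(k < n.+1) bridge_count k *
      tot (n - k) (tilted (half mV)) =
    wsum n o (fun s => \sum_(k < n.+1) (bridge m o (take k s))%:R *
      tilted (half mV) (last o (take k s)) (drop k s)).
    rewrite wsum_sum; apply: eq_bigr => k _.
    rewrite (wsum_prod _ (fun s => (bridge m o s)%:R) (F2 := tilted (half mV))) //.
      exact/tilted_invariant/half_invariant/mV_scaled.
    by rewrite -ltnS.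
  apply: ler_wsum => s sn _.
  case hs: (half m o s); last first.
    by apply: sumr_ge0 => k _; rewrite mulr_ge0 ?tilted_ge0.
  have [k ks /and3P[_ bk hk]] := cut_at_min m_gt0 hs.
  rewrite -sn (bigD1 (inord k)) //= inordK // -[leLHS]addr0; apply: lerD.
    rewrite bk mul1r /tilted hk mulr1; apply: tilt_ge1.
    case/lastP: (drop k s) hk => [|r w] //; rewrite last_rcons.
    by case/andP=> _; rewrite all_rcons => /andP[]; rewrite ltV // => /ltW.
  by apply: sumr_ge0 => j _; rewrite mulr_ge0 ?tilted_ge0.
apply: le_trans (ler_wpM2l (zX_ge0 n) le1) _; rewrite mulr_sumr.
apply: le_trans (tilted_half_sum_le n.+1 (or_intror erefl)).
rewrite [leRHS](reindex_inj rev_ord_inj) /=; apply: ler_sum => k _.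
rewrite subSS -{1}(subnK (n := n) (m := k)); last by rewrite -ltnS.
rewrite exprD -mulrA ler_wpM2l ?zX_ge0 // mulrA ler_piMl //.
  by apply: tot_ge0 => x s; exact: tilted_ge0.
by rewrite exprVn mulrC ler_pdivrMr ?exprn_gt0 // mul1r.
Qed.

(** Mass transport turns walks that end at a highest point into walks below their
start with weight [Delta], and [Delta <= 1] gives [Delta <= sqrt Delta]. *)
Lemma peak_count k : tot k (fun x s => (peak m x s)%:R) <= tot k (tilted (weak_half m)).
Proof.
pose F x s : R := (peak m x s)%:R.
rewrite /tot (@wsum_rev _ _ _ _ nb_uniq Gam_inj nb_Gam _ m_gt0 m_Gam
  edge_mass_transport k o F); last first.
  move=> g x s Gg; have [a a0 ha] := m_scaled Gg; congr (_%:R).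
  rewrite /peak uniq_map_Gam // -map_cons all_map last_map; congr (nat_of_bool (_ && _)).
  by apply: eq_all => v /=; rewrite !ha ler_pM2l.
apply: ler_wsum => s _ _; rewrite /F /tilted.
have E : last o s :: rev (belast o s) = rev (o :: s) by rewrite (lastI o s) rev_rcons.
have lr : last (last o s) (rev (belast o s)) = o.
  by case: s {E} => [|y s] //=; rewrite rev_cons last_rcons.
rewrite /peak E lr rev_uniq all_rev /weak_half /= lexx /=.
case: andP => [[_ ws]|_]; last by rewrite !mulr0.
rewrite !mulr1; apply: le_tilt.
by case/lastP: s ws {E lr} => [|s w] //; rewrite last_rcons all_rcons => /andP[].
Qed.

(** Cut at the last highest point: the part up to it is summable by mass transport,
the part after it is a half-space walk. *)
Lemma saw_count_le n : saw_count n <=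
  Num.sqrt rise * mu * half_bound ^+ 2 * mu ^+ n.
Proof.
have le1 : saw_count n <=
    \sum_(k < n.+1) tot k (tilted (weak_half m)) *
      tot (n - k) (fun x s => (half m x s)%:R).
  apply: (@le_trans _ _ (\sum_(k < n.+1) tot k (fun x s => (peak m x s)%:R) *
      tot (n - k) (fun x s => (half m x s)%:R))); last first.
    apply: ler_sum => k _; rewrite ler_wpM2r ?peak_count //.
    exact: tot_ge0.
  have -> : \sum_(k < n.+1) tot k (fun x s => (peak m x s)%:R) *
      tot (n - k) (fun x s => (half m x s)%:R) =
    wsum n o (fun s => \sum_(k < n.+1) (peak m o (take k s))%:R *
      (half m (last o (take k s)) (drop k s))%:R).
    rewrite wsum_sum; apply: eq_bigr => k _.
    rewrite (wsum_prod _ (fun s => (peak m o s)%:R)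
      (F2 := fun x s => (half m x s)%:R)) //.
      exact/indicator_invariant/half_invariant/m_scaled.
    by rewrite -ltnS.
  apply: ler_wsum => s sn _.
  case us: (uniq (o :: s)); last by apply: sumr_ge0 => k _; rewrite mulr_ge0.
  have [k ks /andP[pk hk]] := cut_at_max m us.
  rewrite -sn (bigD1 (inord k)) //= inordK // pk hk mulr1 lerDl.
  by apply: sumr_ge0 => j _; rewrite mulr_ge0.
rewrite -ler_pdivrMr ?exprn_gt0 // mulrC -exprVn.
apply: le_trans (ler_wpM2l (zX_ge0 n) le1) _; rewrite mulr_sumr.
rewrite expr2 mulrA; apply: le_trans (ler_wpM2r _ (tilted_weak_half_sum_le n.+1)).
  rewrite mulr_suml; apply: ler_sum => k _.
  rewrite -{1}(subnKC (m := k) (n := n)); last by rewrite -ltnS.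
  rewrite exprD mulrACA ler_wpM2l ?half_count_le // mulr_ge0 ?zX_ge0 //.
  by apply: tot_ge0 => x s; exact: tilted_ge0.
exact: expR_ge0.
Qed.

End Critical.

Lemma saw_count_growth : exists mu : R,
  [/\ 0 < mu, saw_count n `^ n%:R^-1 @[n --> \oo] --> mu,
      forall n, mu ^+ n <= saw_count n &
      exists C, forall n, saw_count n <= C * mu ^+ n].
Proof.
have [mu mu_cvg mu_le] := fekete saw_count_ge1 saw_count_submul.
have bridge_le n : bridge_count n <= mu ^+ n.
  case: n => [|n]; first by rewrite bridge_count0.
  apply: (supermul_le_exp saw_count_ge1 mu_cvg) => //; last exact: bridge_count_exp_le.
  exact: wsum_ge0.
have mu_gt0 : 0 < mu.
  apply: lt_le_trans ltr01 (le_trans bridge_count1_ge1 _).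
  by have := bridge_le 1%N; rewrite expr1.
exists mu; split=> //; eexists => n; exact: saw_count_le.
Qed.

End Core.

(** * The susceptibility *)

Section Susceptibility.
Variable R : realType.

Lemma geometric_nneseries (a r : R) : 0 <= r -> r < 1 ->
  (\sum_(0 <= n <oo) (a * r ^+ n)%:E = (a / (1 - r))%:E)%E.
Proof.
move=> r0 r1; apply/cvg_lim => //.
rewrite (_ : (fun N => _) = EFin \o series (geometric a r)); last first.
  by apply/funext => N /=; rewrite sumEFin.
apply: cvg_EFin; first exact: nearW.
apply: cvg_geometric_series; by rewrite ger0_norm.
Qed.

Lemma power_series_bounds (Z : nat -> R) (mu C z : R) : 0 < mu ->
  (forall n, mu ^+ n <= Z n) -> (forall n, Z n <= C * mu ^+ n) ->
  0 <= z -> z < mu^-1 ->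
  ((mu^-1 / (mu^-1 - z))%:E <= \sum_(0 <= n <oo) (z ^+ n * Z n)%:E)%E /\
  (\sum_(0 <= n <oo) (z ^+ n * Z n)%:E <= (C * mu^-1 / (mu^-1 - z))%:E)%E.
Proof.
move=> mu0 lo up z0 zmu.
have r0 : 0 <= z * mu by rewrite mulr_ge0 // ltW.
have r1 : z * mu < 1 by rewrite -ltr_pdivlMr // mul1r.
have E a : a * mu^-1 / (mu^-1 - z) = a / (1 - z * mu).
  by rewrite -mulrA -invfM mulrBr divff ?gt_eqF // [mu * z]mulrC.
have term n c : z ^+ n * (c * mu ^+ n) = c * (z * mu) ^+ n by rewrite exprMn mulrCA.
split.
  rewrite -[X in (X / _)%R]mul1r E -geometric_nneseries //.
  apply: lee_nneseries => n _; rewrite lee_fin -term; last first.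
    by rewrite mul1r ler_wpM2l ?exprn_ge0.
  by rewrite mul1r mulr_ge0 ?exprn_ge0 // ltW.
rewrite E -geometric_nneseries //; apply: lee_nneseries => n _.
  by rewrite lee_fin mulr_ge0 ?exprn_ge0 // (le_trans _ (lo n)) // exprn_ge0 // ltW.
by rewrite lee_fin -term ler_wpM2l ?exprn_ge0.
Qed.

End Susceptibility.

(** * Steps between heights *)

Section Nonunimodular.
Variables (R : realType) (V : choiceType) (e : rel V) (Gam : set (V -> V)) (o : V).
Hypothesis e_simple : simple_graph e.
Hypothesis e_connected : connected_graph e.
Hypothesis e_locally_finite : locally_finite e.
Hypothesis Gam_group : Aut_subgroup e Gam.
Hypothesis Gam_transitive : transitive_action Gam.
Local Notation m := (height R Gam o).
Local Notation nb := (neighbours e).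

Let m_gt0 x : 0 < m x.
Proof. exact: (height_gt0 R e_connected e_locally_finite Gam_group). Qed.

Let m_Gam g x y : Gam g -> m (g x) / m (g y) = m x / m y.
Proof. exact: (height_Gam R e_connected e_locally_finite Gam_group). Qed.

(** Otherwise heights would be constant along paths, hence on the graph. *)
Lemma exists_rising_edge : ~ unimodular R Gam -> exists u v, e u v /\ m u < m v.
Proof.
move=> nonuni; apply: contrapT => no; apply: nonuni => x y.
have es : symmetric e by case: e_simple.
have edge u v : e u v -> m u = m v.
  move=> uv; apply/eqP; rewrite eq_le !leNgt; apply/andP; split; apply/negP => lt.
    by apply: no; exists v, u; rewrite es.
  by apply: no; exists u, v.
have [s ps <-] := e_connected x y.
rewrite -(height_ratio R e_connected e_locally_finite Gam_group o).
have -> : m (last x s) = m x.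
  elim: s x ps => //= z s IH x /andP[xz ps]; by rewrite IH // -(edge _ _ xz).
by rewrite divff // gt_eqF.
Qed.

(** Translates of a single rising edge, so the ratio is the same at all vertices. *)
Lemma higher_neighbour : ~ unimodular R Gam -> exists rise, forall x,
  exists u, [/\ x \in nb u, m x < m u & m u = rise * m x].
Proof.
move=> /exists_rising_edge[u [v [uv muv]]].
exists (m v / m u) => x; have [g Gg <-] := Gam_transitive u x.
have ratio : m (g v) = m v / m u * m (g u).
  by rewrite -(m_Gam v u Gg) divfK // gt_eqF.
exists (g v); split=> //.
  by rewrite mem_neighbours // (Gam_adj Gam_group) //; case: e_simple => ->.
by rewrite ratio ltr_pMl // ltr_pdivlMr // mul1r.
Qed.

(** By transitivity and local finiteness only finitely many height ratios occur
along the edges, so descending steps descend by a definite factor. *)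
Lemma falling_factor : exists fall, [/\ 0 <= fall, fall < 1 &
  forall x y, y \in nb x -> m y < m x -> m y <= fall * m x].
Proof.
have [c [c0 c1 cP]] : exists c, [/\ 0 <= c, c < 1 &
    forall y, y \in nb o -> m y < m o -> m y <= c * m o].
  elim: (nb o) => [|w l [c [c0 c1 cP]]]; first by exists 0; split.
  case: (ltP (m w) (m o)) => wo; last first.
    exists c; split=> // y; rewrite inE => /orP[/eqP ->|]; last exact: cP.
    by rewrite ltNge wo.
  exists (Num.max c (m w / m o)); split; first by rewrite le_max c0.
    by rewrite gt_max c1 ltr_pdivrMr // mul1r.
  move=> y; rewrite inE => /orP[/eqP -> _|/cP yc /yc].
    by rewrite -ler_pdivrMr // le_max lexx orbT.
  by move=> h; apply: (le_trans h); rewrite ler_pM2r // le_max lexx.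
exists c; split=> // x y xy yx; have [g Gg gx] := Gam_transitive x o.
have E : m y / m x = m (g y) / m o by rewrite -(m_Gam y x Gg) gx.
have lt1 : m (g y) < m o.
  by rewrite -[ltRHS]mul1r -ltr_pdivrMr // -E ltr_pdivrMr // mul1r.
rewrite -ler_pdivrMr // E ler_pdivrMr //; apply: cP => //.
rewrite mem_neighbours // -{1}gx (Gam_adj Gam_group) //.
by move: xy; rewrite mem_neighbours.
Qed.

End Nonunimodular.

Lemma SAW_countE (R : realType) (V : choiceType) (e : rel V) (o : V) n :
  locally_finite e -> (SAW_count e o n)%:R = saw_count R (neighbours e) o n.
Proof.
move=> lf; have nbE x y := mem_neighbours lf x y.
rewrite /saw_count /tot /wsum -natr_sum -big_mkcond sum1_count -size_filter.
congr (_%:R); have memE s : (s \in [seq s <- walks (neighbours e) n o | uniq (o :: s)]) =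
    `[< SAW e o n s >].
  rewrite mem_filter mem_walks (eq_path (e' := e)) //.
  by apply/idP/asboolP => [/and3P[us /eqP sn ps]|[-> -> ->]] //; rewrite eqxx.
have finS : finite_set (SAW e o n).
  apply: (@sub_finite_set _ _
    [set` [seq s <- walks (neighbours e) n o | uniq (o :: s)]]); last exact: finite_seq.
  by move=> s Ss /=; rewrite memE; exact/asboolP.
apply: perm_size; apply: uniq_perm.
- exact: fset_uniq.
- apply/filter_uniq/walks_uniq => x; exact: neighbours_uniq.
by move=> s; rewrite memE in_fset_set // inE; apply/idP/asboolP.
Qed.

Theorem theorem1p3 (R : realType) (V : choiceType) (e : rel V) (o : V)
    (e_simple : simple_graph e)
    (e_connected : connected_graph e)
    (e_locally_finite : locally_finite e)
    (e_nonunimodular : exists Gam : set (V -> V),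
        [/\ Aut_subgroup e Gam, transitive_action Gam & ~ unimodular R Gam]) :
  let mu_c : R := connective_constant R e o in
  let z_c : R := critical_z R e o in
  exists C : R,
    (forall z : R, 0 <= z -> z < z_c ->
       ((z_c / (z_c - z))%:E <= susceptibility e o z)%E /\
       (susceptibility e o z <= (C * z_c / (z_c - z))%:E)%E) /\
    (forall n : nat,
       mu_c ^+ n <= (SAW_count e o n)%:R /\
       (SAW_count e o n)%:R <= C * mu_c ^+ n).
Proof.
move: e_nonunimodular => [Gam [Gam_group Gam_trans nonuni]] mu_c z_c.
have [rise higher] := higher_neighbour o e_simple e_connected e_locally_finite
  Gam_group Gam_trans nonuni.
have [fall [fall_ge0 fall_lt1 lower]] := falling_factor R o e_connected
  e_locally_finite Gam_group Gam_trans.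
have [mu [mu_gt0 mu_cvg lo [C up]]] := saw_count_growth o
  (fun x => neighbours_uniq e x) (Gam_inj Gam_group)
  (neighbours_Gam e_locally_finite Gam_group) Gam_trans
  (height_gt0 R e_connected e_locally_finite Gam_group o)
  (@height_Gam R _ _ _ e_connected e_locally_finite Gam_group o)
  (@height_edge_transport R _ _ _ e_simple e_connected e_locally_finite Gam_group
    Gam_trans o)
  higher fall_ge0 fall_lt1 lower.
have ZE n := SAW_countE R o n e_locally_finite.
have muE : mu_c = mu.
  rewrite /mu_c /connective_constant; apply/cvg_lim => //.
  by under eq_fun do rewrite ZE.
have lo' n : mu ^+ n <= (SAW_count e o n)%:R by rewrite ZE.
have up' n : (SAW_count e o n)%:R <= C * mu ^+ n by rewrite ZE.
exists C; rewrite /z_c /critical_z -/mu_c muE; split=> [z z0 zz|n]; last by split.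
exact: power_series_bounds.
Qed.
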